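(* Let $\mathcal T=\{T_t\}_{t\in\mathbb R}$ and $\mathcal S=\{S_t\}_{t\in\mathbb R}$ be weakly mixing measure-preserving flows on standard Borel probability spaces $(X,\mathcal B,\mu)$ and $(Y,\mathcal C,\nu)$ respectively. Assume that for some real sequences $(a_n)_{n\in\mathbb N}$ and $(b_n)_{n\in\mathbb N}$ we have $$\mu_{a_n,b_n}\to(1-\alpha)\int_{\mathbb R^2}\mu_{-t,-u}\,dP(t,u)+\alpha\,\xi_1$$ and $$\nu_{a_n,b_n}\to(1-\alpha')\int_{\mathbb R^2}\nu_{-t,-u}\,dQ(t,u)+\alpha'\,\xi_2$$ for some $0\le\alpha,\alpha'<1$, Borel probability measures $P,Q$ on $\mathbb R^2$, and $\xi_1\in J_3(\mathcal T)$, $\xi_2\in J_3(\mathcal S)$. Assume moreover that there exists a Borel set $B\subset\mathbb R^2$ such that $$(1-\alpha)P(B)-(1-\alpha')Q(B)>\alpha'.$$ Then $\mathcal T$ and $\mathcal S$ are disjoint.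
   Context: For a measure-preserving flow $\mathcal T$ on $(X,\mathcal B,\mu)$, $J_3(\mathcal T)$ is the set of 3-self-joinings: probability measures on $X^3$ invariant under $T_t\times T_t\times T_t$ for all $t$, with all three one-dimensional marginals equal to $\mu$. For $t,s\in\mathbb R$ the 3-off-diagonal joining $\mu_{t,s}\in J_3(\mathcal T)$ is given by $$\mu_{t,s}(A_1\times A_2\times A_3)=\mu(T_{-t}A_1\cap T_{-s}A_2\cap A_3),\quad A_i\in\mathcal B,$$ and $\int_{\mathbb R^2}\mu_{-t,-u}\,dP(t,u)$ is the 3-self-joining whose value on $A_1\times A_2\times A_3$ is $\int_{\mathbb R^2}\mu_{-t,-u}(A_1\times A_2\times A_3)\,dP(t,u)$. The measures $\nu_{t,s}$ are defined analogously for $\mathcal S$. Convergence of joinings is weak convergence: convergence of the values on each product $A_1\times A_2\times A_3$ of measurable sets. Flows $\mathcal T$, $\mathcal S$ are disjoint if $\mu\otimes\nu$ is the only $(T_t\times S_t)_{t\in\mathbb R}$-invariant probability measure on $X\times Y$ with marginals $\mu$ and $\nu$. *)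

(* Defs.v *)
From HB Require Import structures.
From mathcomp Require Import all_boot all_order all_algebra.
From mathcomp Require Import all_classical all_reals all_analysis.

Set Implicit Arguments.
Unset Strict Implicit.
Unset Printing Implicit Defensive.
Import Order.TTheory GRing.Theory Num.Theory.
Import numFieldNormedType.Exports.
Local Open Scope classical_set_scope.
Local Open Scope ring_scope.

(* Isomorphism with a Polish space carrying its Borel sigma-algebra. A
   pseudometric space is metric exactly when it is Hausdorff. *)
Definition standard_borel (R : realType) (d : measure_display)
    (X : measurableType d) : Prop :=
  exists (M : completePseudoMetricType R) (f : X -> M),
    [/\ hausdorff_space M,
        exists2 D : set M, countable D & dense D,
        bijective f
      & forall A : set X, measurable A <-> <<s open >> (f @` A)].

(* Set functions, rather than bundled measures, so that these predicates also
   apply to product measures, pushforwards and mixtures. *)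
Definition flow_invariant (R : realType) (d : measure_display)
    (Z : measurableType d) (m : set Z -> \bar R) (F : R -> Z -> Z) : Prop :=
  forall (t : R) (A : set Z), measurable A -> m (F t @^-1` A) = m A.

(* Invertibility of [F t] follows from the group law. *)
Record mp_flow (R : realType) (d : measure_display) (Z : measurableType d)
    (m : set Z -> \bar R) (F : R -> Z -> Z) : Prop := MpFlow {
  flow0 : forall x, F 0 x = x ;
  flowD : forall s t x, F (s + t) x = F s (F t x) ;
  measurable_flow : measurable_fun [set: R * Z] (fun p => F p.1 p.2) ;
  flow_preserving : flow_invariant m F }.

Definition prod_flow (R X Y : Type) (T : R -> X -> X) (S : R -> Y -> Y) :
    R -> X * Y -> X * Y :=
  fun t p => (T t p.1, S t p.2).

(* Invariance of [A] is modulo null sets, for each time [t]. *)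
Definition ergodic (R : realType) (d : measure_display) (Z : measurableType d)
    (m : set Z -> \bar R) (F : R -> Z -> Z) : Prop :=
  forall A : set Z, measurable A ->
    (forall t, m ((F t @^-1` A) `+` A) = 0%E) -> m A = 0%E \/ m A = 1%E.

(* Weak mixing as ergodicity of the Cartesian square of the flow. *)
Definition weakly_mixing (R : realType) (d : measure_display)
    (X : measurableType d) (mu : probability X R) (T : R -> X -> X) : Prop :=
  ergodic (mu \x mu)%E (prod_flow T T).

Definition joining (R : realType) (dX dY : measure_display)
    (X : measurableType dX) (Y : measurableType dY)
    (mu : set X -> \bar R) (nu : set Y -> \bar R)
    (T : R -> X -> X) (S : R -> Y -> Y) (rho : set (X * Y) -> \bar R) : Prop :=
  [/\ flow_invariant rho (prod_flow T S),
      forall A, measurable A -> rho (A `*` [set: Y]) = mu A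
    & forall B, measurable B -> rho ([set: X] `*` B) = nu B].

(* The product measure is a joining, and the only one. *)
Definition disjoint_flows (R : realType) (dX dY : measure_display)
    (X : measurableType dX) (Y : measurableType dY)
    (mu : probability X R) (nu : probability Y R)
    (T : R -> X -> X) (S : R -> Y -> Y) : Prop :=
  forall rho : probability (X * Y)%type R,
    joining mu nu T S rho <->
    forall C, measurable C -> rho C = (mu \x nu)%E C.

Definition self_joining3 (R : realType) (d : measure_display)
    (X : measurableType d) (mu : set X -> \bar R) (T : R -> X -> X)
    (xi : set (X * X * X) -> \bar R) : Prop :=
  [/\ flow_invariant xi (prod_flow (prod_flow T T) T),
      forall A, measurable A -> xi (A `*` [set: X] `*` [set: X]) = mu A,
      forall A, measurable A -> xi ([set: X] `*` A `*` [set: X]) = mu A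
    & forall A, measurable A -> xi ([set: X] `*` [set: X] `*` A) = mu A].

(* The measure carried by the graph of [x |-> (T_t x, T_s x)]; lemma
   [offdiagE] gives its values on boxes. *)
Definition offdiag (R : realType) (d : measure_display) (X : measurableType d)
    (mu : set X -> \bar R) (T : R -> X -> X) (t s : R) :
    set (X * X * X) -> \bar R :=
  pushforward mu (fun x => (T t x, T s x, x)).

Definition offdiag_mix (R : realType) (d : measure_display)
    (X : measurableType d) (mu : set X -> \bar R) (T : R -> X -> X)
    (P : probability (R * R)%type R) : set (X * X * X) -> \bar R :=
  fun A => (\int[P]_p offdiag mu T (- p.1) (- p.2) A)%E.

Definition joining3_cvg (R : realType) (d : measure_display)
    (X : measurableType d) (m_ : nat -> set (X * X * X) -> \bar R)
    (m : set (X * X * X) -> \bar R) : Prop :=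
  forall A1 A2 A3 : set X, measurable A1 -> measurable A2 -> measurable A3 ->
    m_ n (A1 `*` A2 `*` A3) @[n --> \oo] --> m (A1 `*` A2 `*` A3).

Section offdiag_theory.
Context (R : realType) (d : measure_display) (X : measurableType d).
Context (mu : set X -> \bar R) (T : R -> X -> X).
Hypothesis flowT : mp_flow mu T.

Lemma flowK t : cancel (T t) (T (- t)).
Proof. by move=> x; rewrite -(flowD flowT) addNr (flow0 flowT). Qed.

Lemma flowVK t : cancel (T (- t)) (T t).
Proof. by move=> x; rewrite -(flowD flowT) addrN (flow0 flowT). Qed.

Lemma image_flowN t A : T (- t) @` A = T t @^-1` A.
Proof.
apply/seteqP; split => [_ [x Ax <-]|x Ax] /=; first by rewrite flowVK.
by exists (T t x) => //; rewrite flowK.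
Qed.

Lemma measurable_flow_at t : measurable_fun [set: X] (T t).
Proof.
apply: (measurableT_comp (measurable_flow flowT) (g := fun x => (t, x))).
exact: pair1_measurable.
Qed.

Lemma offdiagE t s A1 A2 A3 : offdiag mu T t s (A1 `*` A2 `*` A3) =
  mu ((T (- t) @` A1) `&` (T (- s) @` A2) `&` A3).
Proof. by rewrite !image_flowN. Qed.

Lemma self_joining3_offdiag t s : self_joining3 mu T (offdiag mu T t s).
Proof.
have mf u : measurable_fun [set: X] (T u) by exact: measurable_flow_at.
split => [r A mA|A mA|A mA|A mA]; rewrite /offdiag /pushforward.
- pose h x := (T t x, T s x, x).
  have mh : measurable (h @^-1` A).
    rewrite -[X in measurable X]setTI.
    by do !apply: measurable_fun_pair => //.
  rewrite -[RHS](flow_preserving flowT r mh); congr (mu _).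
  apply/seteqP; split => x;
    by rewrite /= /prod_flow /h /= -!(flowD flowT) (addrC r t) (addrC r s).
- rewrite -(flow_preserving flowT t mA); congr (mu _).
  by apply/seteqP; split => x //= [[]].
- rewrite -(flow_preserving flowT s mA); congr (mu _).
  by apply/seteqP; split => x //= [[]].
- by congr (mu _); apply/seteqP; split => x //= [[]].
Qed.

End offdiag_theory.

(* Main.v *)
Require Import Defs.
From HB Require Import structures.
From mathcomp Require Import all_boot all_order all_algebra.
From mathcomp Require Import all_classical all_reals all_analysis.
From mathcomp Require Import measurable_realfun lra ring.
Import Order.TTheory GRing.Theory Num.Theory.
Import numFieldNormedType.Exports.
Local Open Scope classical_set_scope.
Local Open Scope ring_scope.
Set Implicit Arguments.
Unset Strict Implicit.
Unset Printing Implicit Defensive.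

(** Let [rho] be a joining of the two flows with [rho (A `*` B) > mu A * nu B].
    All that is used of [rho] is the finitely biadditive function
    [A, B |-> rho (A `*` B)] (a "bijoining"). Bijoinings form a compact convex
    set, so [rho] may be replaced by one that is extremal along the orbit of
    [(A, B)]; this plays the role of ergodicity of the joining.

    An ultralimit of the joinings [rho_(a_n, b_n)] of the product flow couples
    the two given limits. On the components carried by [P] and [Q] it lifts to
    a coupling of [(1 - alpha) P \x mu] and [(1 - alpha') Q \x nu]. Its part
    above [K `*` K'], for compacts [K] inside [B] and [K'] outside [B] of almost
    full measure, has positive mass by the hypothesis on [B]. Hence there are
    [p <> q] such that the part above any neighbourhood of [(p, q)] is nonzero.
    By extremality this part projects, at each of the three coordinates, to a
    multiple of [rho]. Since the first two coordinates are obtained from the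
    third by translating by about [(- p, - q)], the function
    [s |-> rho (A `*` S_s^-1 B)] is periodic with the nonzero period
    [p.1 - q.1] or [p.2 - q.2]. It is also continuous, and by weak mixing it
    equals [mu A * nu B] in quadratic mean; so it is constant: a contradiction. *)

(** * Bounded families, ultralimits and invariant means *)

(** Ultralimits and invariant means replace weak compactness; only finite additivity survives them.
    Countable additivity returns whenever a finitely additive function lies below a finite measure,
    and then densities, product measures and ergodicity can be used again. Extremality matters only
    along one orbit, so countably many maximizations and continuity in time can stand in for an
    ergodic decomposition. The obstacle is the lift to the plane. The limits are known on boxes
    only, and of the ultralimit one knows just that its marginals dominate the lifted parts, box by
    box. The lift is therefore glued over finite partitions into boxes. The flow does not preserve
    these, so invariance is restored afterwards by averaging. Positivity above [K] and [K'] is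
    inclusion-exclusion: the hypothesis says that (1 - alpha) P(B) + (1 - alpha') Q(complement of B)
    exceeds 1, the total mass of the ultralimit, so the two parts must meet. It is enough to exclude
    an excess over the product: a deficit at [A] is an excess at its complement. *)

Definition bounded_family (R : realType) (I : Type) (u : I -> R) :=
  exists b, forall i, `|u i| <= b.

Section bounded_family.
Context {R : realType} {I : Type}.
Implicit Types u v : I -> R.

Lemma bounded_familyD u v : bounded_family u -> bounded_family v ->
  bounded_family (fun i => u i + v i).
Proof.
move=> [b ub] [c vc]; exists (b + c) => i.
by rewrite (le_trans (ler_normD _ _))// lerD.
Qed.

Lemma bounded_familyZ a u : bounded_family u ->
  bounded_family (fun i => a * u i).
Proof.
move=> [b ub]; exists (`|a| * b) => i.
by rewrite normrM ler_wpM2l.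
Qed.

Lemma bounded_familyB u v : bounded_family u -> bounded_family v ->
  bounded_family (fun i => u i - v i).
Proof.
move=> bu bv; have := bounded_familyD bu (bounded_familyZ (-1) bv).
by under eq_fun do rewrite mulN1r.
Qed.

Lemma bounded_familyM u v : bounded_family u -> bounded_family v ->
  bounded_family (fun i => u i * v i).
Proof.
move=> [b ub] [c vc]; exists (b * c) => i.
by rewrite normrM ler_pM.
Qed.

Lemma bounded_family_itv u (a b : R) : (forall i, a <= u i <= b) ->
  bounded_family u.
Proof.
move=> uab; exists (`|a| + `|b|) => i; have /andP[au ub] := uab i.
have := ler_norm (- a); have := ler_norm b; have := normr_ge0 b; have := normr_ge0 a.
by rewrite normrN ler_norml => ? ? ? ?; apply/andP; split; lra.
Qed.

Lemma bounded_family_cst (a : R) : bounded_family (fun _ : I => a).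
Proof. by exists `|a|. Qed.

End bounded_family.

Lemma bounded_family_comp (R : realType) (I J : Type) (f : J -> I) (u : I -> R) :
  bounded_family u -> bounded_family (u \o f).
Proof. by move=> [b ub]; exists b => j /=. Qed.

Definition ulim (R : realType) (I : Type) (U : set_system I) (u : I -> R) : R :=
  lim (u @ U).

Section ultralimit.
Context {R : realType} {I : Type} (U : set_system I) {UU : UltraFilter U}.
Implicit Types u v : I -> R.

(** Values in a compact segment have a cluster point, and an ultrafilter converges to each of its
    cluster points. *)
Lemma ulimP u : bounded_family u -> u @ U --> ulim U u.
Proof.
move=> [b ub]; apply: cvgP.
have [p [_ clp]] : `[- b, b]%classic `&` cluster (u @ U) !=set0.
  apply: (@segment_compact R (- b) b (u @ U)).
  by rewrite /= /fmap/=; apply: filterE => i; rewrite /= in_itv/= -ler_norml.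
apply: (@cvgP _ _ p) => V Vp.
have [//|nV] := in_ultra_setVsetC (u @^-1` V) UU.
have [y [+ Vy]] := clp (~` V) V nV Vp.
by [].
Qed.

Lemma ulim_eq u l : u @ U --> l -> ulim U u = l.
Proof. exact: cvg_lim. Qed.

Lemma ulim_cst (a : R) : ulim U (fun=> a) = a.
Proof. by apply: ulim_eq; exact: cvg_cst. Qed.

Lemma ulimD u v : bounded_family u -> bounded_family v ->
  ulim U (fun i => u i + v i) = ulim U u + ulim U v.
Proof. by move=> /ulimP bu /ulimP bv; apply: ulim_eq; exact: cvgD. Qed.

Lemma ulimZ a u : bounded_family u ->
  ulim U (fun i => a * u i) = a * ulim U u.
Proof. by move=> /ulimP bu; apply: ulim_eq; apply: cvgM => //; exact: cvg_cst. Qed.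

Lemma ulim_le u v : bounded_family u -> bounded_family v ->
  (\forall i \near U, u i <= v i) -> ulim U u <= ulim U v.
Proof.
move=> /ulimP bu /ulimP bv uv.
rewrite -subr_ge0; apply: cvgr_to_ge (cvgB bv bu) _.
by apply: filterS uv => i; rewrite subr_ge0.
Qed.

End ultralimit.

(** Shared by ultralimits and by the invariant mean on the line, so that averaging of bijoinings is
    treated once for both. *)
Record mean_functional (R : realType) (I : Type) (M : (I -> R) -> R) : Prop :=
  MeanFunctional {
    mean_cst : forall a, M (fun=> a) = a ;
    meanD : forall u v, bounded_family u -> bounded_family v ->
      M (fun i => u i + v i) = M u + M v ;
    meanZ : forall a u, bounded_family u -> M (fun i => a * u i) = a * M u ;
    mean_le : forall u v, bounded_family u -> bounded_family v ->
      (forall i, u i <= v i) -> M u <= M v }.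

Lemma ulim_mean (R : realType) (I : Type) (U : set_system I) :
  UltraFilter U -> mean_functional (@ulim R I U).
Proof.
move=> UU; split.
- exact: ulim_cst.
- by move=> u v; exact: ulimD.
- by move=> a u; exact: ulimZ.
- by move=> u v bu bv uv; apply: ulim_le => //; exact: filterE.
Qed.

Record invariant_mean (R : realType) (M : (R -> R) -> R) : Prop := InvariantMean {
  invariant_mean_functional :> mean_functional M ;
  mean_shift : forall s u, bounded_family u -> M (fun t => u (t + s)) = M u }.

Section mean_existence.
Context {R : realType}.
Implicit Types (u v : R -> R) (l : seq R).

Definition step_avg (s : R) (n : nat) u : R -> R :=
  fun t => n.+1%:R^-1 * \sum_(j < n.+1) u (t + j%:R * s).

(** Averages over boxes in the subgroup of the line spanned by [l]. They play the part of Folner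
    sets: for large [n] they are almost invariant under every member of [l]. *)
Definition multi_avg l n u : R -> R := foldr (fun s v => step_avg s n v) u l.

Lemma step_avg_le s n u v : (forall t, u t <= v t) ->
  forall t, step_avg s n u t <= step_avg s n v t.
Proof.
by move=> uv t; rewrite ler_wpM2l ?invr_ge0//; apply: ler_sum => i _.
Qed.

Lemma step_avg_cst s n a : step_avg s n (fun=> a) = fun=> a.
Proof.
apply/funext => t; rewrite /step_avg sumr_const card_ord -(mulr_natl a) mulrA.
by rewrite mulVf ?pnatr_eq0// mul1r.
Qed.

Lemma step_avgD s n u v :
  step_avg s n (fun t => u t + v t) = fun t => step_avg s n u t + step_avg s n v t.
Proof. by apply/funext => t; rewrite /step_avg big_split/= mulrDr. Qed.

Lemma step_avgZ s n a u :
  step_avg s n (fun t => a * u t) = fun t => a * step_avg s n u t.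
Proof.
by apply/funext => t; rewrite /step_avg -mulr_sumr !mulrA (mulrC a).
Qed.

Lemma step_avg_shift s n h u :
  step_avg s n (fun t => u (t + h)) = fun t => step_avg s n u (t + h).
Proof.
apply/funext => t; rewrite /step_avg; congr (_ * _); apply: eq_bigr => i _.
by rewrite addrAC.
Qed.

Lemma multi_avg_le l n u v : (forall t, u t <= v t) ->
  forall t, multi_avg l n u t <= multi_avg l n v t.
Proof. by move=> uv; elim: l => //= s l ih; exact: step_avg_le. Qed.

Lemma multi_avg_cst l n a : multi_avg l n (fun=> a) = fun=> a.
Proof. by elim: l => //= s l ->; rewrite step_avg_cst. Qed.

Lemma multi_avgD l n u v :
  multi_avg l n (fun t => u t + v t) =
  fun t => multi_avg l n u t + multi_avg l n v t.
Proof. by elim: l => //= s l ->; rewrite step_avgD. Qed.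

Lemma multi_avgZ l n a u :
  multi_avg l n (fun t => a * u t) = fun t => a * multi_avg l n u t.
Proof. by elim: l => //= s l ->; rewrite step_avgZ. Qed.

Lemma multi_avg_shift l n h u :
  multi_avg l n (fun t => u (t + h)) = fun t => multi_avg l n u (t + h).
Proof. by elim: l => //= s l ->; rewrite step_avg_shift. Qed.

Lemma multi_avg_norm l n u b : (forall t, `|u t| <= b) ->
  forall t, `|multi_avg l n u t| <= b.
Proof.
move=> ub t; rewrite ler_norml; apply/andP; split.
  rewrite -[leLHS](congr1 (fun f => f t) (multi_avg_cst l n (- b))).
  by apply: multi_avg_le => x; have := ub x; rewrite ler_norml => /andP[].
rewrite -[leRHS](congr1 (fun f => f t) (multi_avg_cst l n b)).
by apply: multi_avg_le => x; have := ub x; rewrite ler_norml => /andP[].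
Qed.

Lemma step_avg_diff s n u b : (forall t, `|u t| <= b) ->
  forall t, `|step_avg s n (fun t => u (t + s) - u t) t| <= n.+1%:R^-1 * (b + b).
Proof.
move=> ub t; rewrite normrM ger0_norm ?invr_ge0// ler_wpM2l ?invr_ge0//.
suff -> : \sum_(j < n.+1) (u (t + j%:R * s + s) - u (t + j%:R * s)) =
          u (t + n.+1%:R * s) - u t.
  by rewrite (le_trans (ler_normB _ _))// lerD.
rewrite -(big_mkord xpredT (fun j => u (t + j%:R * s + s) - u (t + j%:R * s))).
under eq_bigr => j _.
  have -> : t + j%:R * s + s = t + j.+1%:R * s by rewrite -natr1; ring.
  over.
by rewrite (telescope_sumr (fun j => u (t + j%:R * s)))// mul0r addr0.
Qed.

(** Averaging commutes with translation, so the step in direction [s] telescopes to two boundary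
    terms, and averaging in the other directions does not increase the bound. *)
Lemma multi_avg_diff l n s u b : (forall t, `|u t| <= b) -> s \in l ->
  forall t, `|multi_avg l n (fun t => u (t + s) - u t) t| <= n.+1%:R^-1 * (b + b).
Proof.
move=> ub; elim: l => //= h l ih; rewrite inE => /predU1P[<-|/ih {}ih] t.
  have -> : (fun t => u (t + s) - u t) = (fun t => u (t + s) + -1 * u t).
    by apply/funext => x; rewrite mulN1r.
  rewrite multi_avgD multi_avgZ multi_avg_shift.
  under [X in step_avg s n X]eq_fun do rewrite mulN1r.
  by apply: step_avg_diff; exact: multi_avg_norm.
exact: (@multi_avg_norm [:: h]).
Qed.

Let base (p : seq R * nat) : set (seq R * nat) :=
  [set q : seq R * nat | {subset p.1 <= q.1} /\ (p.2 <= q.2)%N].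

(** Amenability of the line as a discrete group. Along the ultrafilter [l] absorbs every finite list
    of directions and [n] tends to infinity. *)
Lemma invariant_mean_exists : exists M : (R -> R) -> R, invariant_mean M.
Proof.
have PF : ProperFilter (filter_from setT base).
  apply: filter_from_proper => [|[l n] _]; last by exists (l, n); split.
  apply: filter_from_filter; first by exists ([::], 0%N).
  move=> [l1 n1] [l2 n2] _ _; exists (l1 ++ l2, maxn n1 n2) => // -[l n] [/= sl nn].
  rewrite geq_max in nn; have [? ?] := andP nn.
  by split; split => //= x xl; apply: sl; rewrite mem_cat xl ?orbT.
have [U [UU subU]] := ultraFilterLemma PF.
have bnd u t : bounded_family u ->
    bounded_family (fun p : seq R * nat => multi_avg p.1 p.2 u t).
  by move=> [b ub]; exists b => p; exact: multi_avg_norm.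
exists (fun u => ulim U (fun p => multi_avg p.1 p.2 u 0)); split; first split.
- by move=> a; under eq_fun do rewrite multi_avg_cst; rewrite ulim_cst.
- move=> u v bu bv; under eq_fun do rewrite multi_avgD.
  by rewrite ulimD//; exact: bnd.
- move=> a u bu; under eq_fun do rewrite multi_avgZ.
  by rewrite ulimZ//; exact: bnd.
- move=> u v bu bv uv; apply: ulim_le; [exact: bnd|exact: bnd|].
  by apply: filterE => p; exact: multi_avg_le.
- move=> s u bu; have bus : bounded_family (fun t => u (t + s)).
    exact: (bounded_family_comp (fun t => t + s) bu).
  apply/eqP; rewrite -subr_eq0; apply/eqP.
  rewrite -[in X in _ - X](mul1r (ulim _ _)) -mulNr -ulimZ; last exact: bnd.
  rewrite -ulimD; [|exact: bnd|exact/bounded_familyZ/bnd].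
  apply: ulim_eq; apply/cvgrPdist_le => e e0.
  have [b ub] := bu; have b0 : 0 <= b by exact: le_trans (ub 0).
  (* From [n >= N] on, the boundary error [(b + b) / n.+1] is at most [e]. *)
  pose N := Num.truncn ((b + b) / e).
  apply: subU; exists ([:: s], N) => // -[l n] /= [sl Nn].
  rewrite sub0r normrN.
  have := @multi_avg_diff l n s u b ub (sl _ (mem_head _ _)) 0.
  have -> : (fun t => u (t + s) - u t) = (fun t => u (t + s) + -1 * u t).
    by apply/funext => x; rewrite mulN1r.
  rewrite multi_avgD multi_avgZ => /le_trans; apply.
  rewrite ler_pdivrMl// -ler_pdivrMr//.
  have bbe : 0 <= (b + b) / e by rewrite divr_ge0// ?addr_ge0// ltW.
  rewrite (le_trans (ltW (truncnS_gt _)))// ler_nat.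
  by [].
Qed.

End mean_existence.

Section mean_theory.
Context {R : realType} {I : Type} (M : (I -> R) -> R) (MM : mean_functional M).
Implicit Types u v : I -> R.

Lemma mean_ge0 u : bounded_family u -> (forall i, 0 <= u i) -> 0 <= M u.
Proof.
move=> bu u0; rewrite -(mean_cst MM 0); apply: (mean_le MM) => //.
exact: bounded_family_cst.
Qed.

End mean_theory.

(** * Finitely additive functions dominated by a measure *)

Record submeasure (R : realType) d (Z : measurableType d) (m : set Z -> \bar R)
    (k : set Z -> R) : Prop := Submeasure {
  sub_ge0 : forall A, measurable A -> 0 <= k A ;
  subU : forall A B, measurable A -> measurable B -> A `&` B = set0 ->
    k (A `|` B) = k A + k B ;
  sub_le : forall A, measurable A -> ((k A)%:E <= m A)%E }.

Section submeasure_theory.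
Context {R : realType} d (Z : measurableType d) (m : set Z -> \bar R).
Context (k : set Z -> R) (mk : submeasure m k).

Lemma sub_set0 : k set0 = 0.
Proof.
have := subU mk (@measurable0 _ Z) measurable0 (setI0 _).
by rewrite setU0 => /esym/eqP; rewrite -subr_eq0 addrK => /eqP.
Qed.

Lemma subD A B : measurable A -> measurable B -> B `<=` A ->
  k (A `\` B) = k A - k B.
Proof.
move=> mA mB BA; rewrite -{2}(setDUK BA) (subU mk)//.
- by rewrite addrAC subrr add0r.
- exact: measurableD.
- by rewrite setIC setDKI.
Qed.

Lemma sub_mono A B : measurable A -> measurable B -> A `<=` B -> k A <= k B.
Proof.
move=> mA mB AB; rewrite -subr_ge0 -subD//.
by apply: (sub_ge0 mk); exact: measurableD.
Qed.

Lemma sub_setC A : measurable A -> k (~` A) = k setT - k A.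
Proof. by move=> mA; rewrite -setTD subD. Qed.

Lemma sub_subadd A B : measurable A -> measurable B -> k (A `|` B) <= k A + k B.
Proof.
move=> mA mB; have -> : A `|` B = A `|` (B `\` A) by rewrite setUDr setDv setD0.
rewrite (subU mk)//; last by rewrite setDIK.
  by rewrite lerD2l sub_mono//; exact: measurableD.
exact: measurableD.
Qed.

Lemma sub_finite_sum (I : finType) (c : Z -> I) A :
  (forall i, measurable (c @^-1` [set i])) -> measurable A ->
  k A = \sum_i k (A `&` c @^-1` [set i]).
Proof.
move=> mc mA.
have nilE : [set` [::]] = set0 :> set I by apply/seteqP; split.
have consE i (s : seq I) : [set` i :: s] = [set i] `|` [set` s].
  apply/seteqP; split => j /=; first by rewrite inE => /predU1P.
  by rewrite inE => -[->|->]; rewrite ?eqxx ?orbT.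
have mcs (s : seq I) : measurable (c @^-1` [set` s]).
  elim: s => [|i s ih]; first by rewrite nilE preimage_set0.
  by rewrite consE preimage_setU; exact: measurableU.
suff H (s : seq I) : uniq s ->
    k (A `&` c @^-1` [set` s]) = \sum_(i <- s) k (A `&` c @^-1` [set i]).
  have AE : A `&` c @^-1` [set` index_enum I] = A.
    by apply/seteqP; split => [x []//|x Ax]; split => //=; rewrite mem_index_enum.
  by rewrite -{1}AE H// index_enum_uniq.
elim: s => [|i s ih] /=; first by rewrite big_nil nilE preimage_set0 setI0 sub_set0.
move=> /andP[nis us]; rewrite big_cons -ih// -(subU mk); first last.
- by apply/seteqP; split => // x [[_ /= ->]] [_ /=]; rewrite (negbTE nis).
- exact: measurableI.
- exact: measurableI.
by rewrite -setIUr -preimage_setU -consE.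
Qed.

Lemma sub_bigsetU (F : nat -> set Z) n : (forall i, measurable (F i)) ->
  trivIset setT F -> k (\big[setU/set0]_(i < n) F i) = \sum_(i < n) k (F i).
Proof.
move=> mF tF; elim: n => [|n ih]; first by rewrite !big_ord0 sub_set0.
rewrite !big_ord_recr/= (subU mk)//; first by rewrite ih.
- exact: bigsetU_measurable.
- by apply: (@trivIset_bigsetUI _ xpredT F) => //; exact: sub_trivIset tF.
Qed.

End submeasure_theory.

Lemma fine_submeasure (R : realType) d (Z : measurableType d)
    (m : {finite_measure set Z -> \bar R}) : submeasure m (fine \o m).
Proof.
have fm A : measurable A -> m A \is a fin_num by exact: fin_num_measure.
split=> [A mA|A B mA mB AB|A mA] /=.
- by rewrite fine_ge0.
- by rewrite measureU// fineD// fm.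
- by rewrite fineK// fm.
Qed.

(** Countable additivity is inherited from [m]: what [k] misses after finitely many sets is at most
    what [m] misses, which tends to 0. *)
Lemma submeasure_measure (R : realType) d (Z : measurableType d)
    (m : {finite_measure set Z -> \bar R}) (k : set Z -> R) :
  submeasure m k -> exists mk : {finite_measure set Z -> \bar R},
    forall A, measurable A -> mk A = (k A)%:E.
Proof.
(* Outside the measurable sets [k] may be negative; the absolute value makes the set function
   nonnegative everywhere and changes nothing on measurable sets. *)
move=> sk; pose kf (A : set Z) := `|k A|%:E.
have kfE A : measurable A -> kf A = (k A)%:E.
  by move=> mA; rewrite /kf ger0_norm// (sub_ge0 sk).
have kf0 : kf set0 = 0%E by rewrite kfE// (sub_set0 sk).
have kf_ge0 A : (0 <= kf A)%E by rewrite lee_fin.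
have kfs : semi_sigma_additive kf.
  move=> F mF tF mUF; have sm := fine_submeasure m.
  under eq_fun do rewrite big_mkord; pose G n := \big[setU/set0]_(i < n) F i.
  have mG n : measurable (G n) by exact: bigsetU_measurable.
  have GU n : G n `<=` \bigcup_i F i.
    by rewrite /G -bigcup_mkord => x [i _ Fx]; exists i.
  have -> : (fun n => \sum_(i < n) kf (F i))%E = fun n => (k (G n))%:E.
    apply/funext => n; rewrite (sub_bigsetU sk)// -sumEFin.
    by apply: eq_bigr => i _; rewrite kfE.
  rewrite kfE//; apply: cvg_EFin; first by near=> n.
  rewrite (_ : fine \o _ = fun n => k (G n))//.
  have /fine_cvgP[_ cm] : (fun n => \sum_(0 <= i < n) m (F i))%E @ \oo -->
      (fine (m (\bigcup_i F i)))%:E.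
    by rewrite fineK ?fin_num_measure//; exact: measure_semi_sigma_additive.
  have {}cm : (fun n => (fine \o m) (G n)) @ \oo --> fine (m (\bigcup_i F i)).
    apply: cvg_trans cm; apply: near_eq_cvg; apply: nearW => n /=.
    rewrite big_mkord -sum_fine => [|i _]; last by rewrite fin_num_measure.
    by rewrite -(sub_bigsetU sm).
  have H n : k (\bigcup_i F i) - (fine (m (\bigcup_i F i)) - (fine \o m) (G n)) <=
      k (G n) <= k (\bigcup_i F i).
    rewrite (sub_mono sk)// andbT lerBlDl -lerBlDr -(subD sk)// -(subD sm)//.
    have mD : measurable (\bigcup_i F i `\` G n) by exact: measurableD.
    by rewrite -lee_fin/= fineK ?fin_num_measure//; exact: (sub_le sk).
  apply: (@squeeze_cvgr _ _ _ _ (fun n => k (\bigcup_i F i) -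
      (fine (m (\bigcup_i F i)) - (fine \o m) (G n))) (fun=> k (\bigcup_i F i)));
    [exact: nearW| |exact: cvg_cst].
  rewrite -[X in _ --> X]subr0; apply: cvgB; first exact: cvg_cst.
  by rewrite -(subrr (fine (m (\bigcup_i F i)))); apply: cvgB => //; exact: cvg_cst.
pose K0 : {measure set Z -> \bar R} := HB.pack kf (isMeasure.Build _ _ _ kf kf0 kf_ge0 kfs).
have finK : fin_num_fun K0 by [].
pose K : {finite_measure set Z -> \bar R} := HB.pack kf K0 (Measure_isFinite.Build _ _ _ K0 finK).
by exists K.
Unshelve. all: by end_near. Qed.

Lemma measure_finite_pack (R : realType) d (Z : measurableType d)
    (m : {measure set Z -> \bar R}) : (m setT < +oo)%E ->
  exists m' : {finite_measure set Z -> \bar R}, m' = m :> (set Z -> \bar R).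
Proof.
move=> moo; have finm : fin_num_fun m.
  move=> A mA; rewrite ge0_fin_numE// (le_lt_trans _ moo)//.
  by rewrite le_measure// ?inE.
pose mf : set Z -> \bar R := m.
pose m0 : {measure set Z -> \bar R} := HB.pack mf (isMeasure.Build _ _ _ mf
  (measure0 m) (measure_ge0 m) (@measure_semi_sigma_additive _ _ _ m)).
pose m' : {finite_measure set Z -> \bar R} :=
  HB.pack mf m0 (Measure_isFinite.Build _ _ _ m0 finm).
by exists m'.
Qed.

Section ergodic_submeasure.
Context {R : realType} d (Z : measurableType d).

(* With [f = dk/dm] and [c = k setT], the set where [f > c] is invariant modulo
   null sets, since [k - c m] is positive on each of its non-null subsets and
   nonpositive outside. *)
Lemma ergodic_submeasure_finite (m : {finite_measure set Z -> \bar R})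
    (F : R -> Z -> Z) (k : set Z -> R) :
  m setT = 1%E -> (forall t, measurable_fun setT (F t)) ->
  flow_invariant m F -> ergodic m F -> submeasure m k ->
  (forall t A, measurable A -> k (F t @^-1` A) = k A) ->
  forall A, measurable A -> k A = k setT * fine (m A).
Proof.
move=> m1 mF Fm erg sk Fk.
have [K KE] := submeasure_measure sk.
have fm A : measurable A -> m A \is a fin_num by exact: fin_num_measure.
have Km : K `<< m.
  apply/null_content_dominatesP => A mA mA0; apply/eqP; rewrite eq_le measure_ge0 andbT.
  by rewrite -mA0 KE//; exact: sub_le.
have [f [f0 ffin fint fE]] := radon_nikodym_sigma_finite Km.
have mf : measurable_fun setT f by exact: measurable_int fint.
have {}fE A : measurable A -> (k A)%:E = (\int[m]_(x in A) f x)%E.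
  by move=> mA; rewrite -fE// KE.
pose c := k setT; have c0 : 0 <= c by exact: (sub_ge0 sk).
have kle E : measurable E -> (forall x, E x -> (f x <= c%:E)%E) ->
    k E <= c * fine (m E).
  move=> mE fc; rewrite -lee_fin EFinM fineK ?fm// fE// -integral_cst//.
  by apply: ge0_le_integral => //; exact: measurable_funTS.
pose A := [set x | (c%:E < f x)%E].
have mA : measurable A.
  rewrite -[A]setTI; exact: emeasurable_fun_o_infty.
have kgt E : measurable E -> E `<=` A -> k E <= c * fine (m E) -> m E = 0%E.
  move=> mE EA kE.
  have mfc : measurable_fun E (f \- cst c%:E)%E.
    by apply: emeasurable_funB => //; exact: measurable_funTS.
  have fc_ge0 x : E x -> (0 <= (f \- cst c%:E) x)%E.
    by move=> /EA /ltW fc; rewrite -[leRHS]/(f x - c%:E)%E suber_ge0.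
  have : (\int[m]_(x in E) `|(f \- cst c%:E) x| = 0)%E.
    apply/eqP; rewrite eq_le integral_ge0 ?andbT//.
    have -> : (\int[m]_(x in E) `|(f \- cst c%:E) x| =
               \int[m]_(x in E) (f \- cst c%:E) x)%E.
      by apply: eq_integral => x /set_mem Ex; rewrite gee0_abs// fc_ge0.
    rewrite integralB//; last 2 first.
    - exact: integrableS fint.
    - by apply: finite_measure_integrable_cst.
    rewrite -fE// integral_cst// sube_le0.
    by move: kE; rewrite -lee_fin EFinM fineK ?fm.
  move/(ae_eq_integral_abs _ mE mfc) => [N [mN N0 EN]].
  apply: (subset_measure0 mE mN _ N0) => x Ex; apply: EN => /(_ Ex).
  move=> fcE; have /eqP : (f x - c%:E = 0)%E by exact: fcE.
  rewrite sube_eq ?ffin ?fin_num_adde_defl// add0e => /eqP fc.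
  by have := EA _ Ex; rewrite /A/= fc ltxx.
have mFA t : measurable (F t @^-1` A) by rewrite -[X in measurable X]setTI; exact: mF.
(* By invariance the two halves of the symmetric difference of [A] and its preimage have equal mass,
   for [k] and for [m]. The half outside [A] satisfies [k <= c m], hence so does the half inside
   [A], and [kgt] makes that one null. *)
have swap t (h : set Z -> R) : submeasure m h -> h (F t @^-1` A) = h A ->
    h (A `\` F t @^-1` A) = h ((F t @^-1` A) `\` A).
  have DE A1 A2 : A1 `\` A2 = A1 `\` (A1 `&` A2) :> set Z.
    by rewrite setDIr setDv set0U.
  move=> sh hA; rewrite DE [in RHS]DE setIC.
  by rewrite !(subD sh)// ?hA//; exact: measurableI.
have mD t : m (A `\` F t @^-1` A) = 0%E.
  have mD1 : measurable (A `\` F t @^-1` A) by exact: measurableD.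
  have mD2 : measurable ((F t @^-1` A) `\` A) by exact: measurableD.
  apply: kgt => //.
  have -> := swap t _ sk (Fk t A mA).
  have /= -> := swap t _ (fine_submeasure m) (congr1 fine (Fm t A mA)).
  by apply: kle => // x [_] /negP; rewrite -leNgt.
have invA t : m ((F t @^-1` A) `+` A) = 0%E.
  have mD2 : measurable ((F t @^-1` A) `\` A) by exact: measurableD.
  have mD1 : measurable (A `\` F t @^-1` A) by exact: measurableD.
  have mD20 : m ((F t @^-1` A) `\` A) = 0%E.
    rewrite -[LHS]fineK ?fm//.
    have /= <- := swap t _ (fine_submeasure m) (congr1 fine (Fm t A mA)).
    by rewrite mD.
  transitivity (m ((F t @^-1` A) `\` A) + m (A `\` F t @^-1` A))%E.
    by apply: measureU => //; apply/seteqP; split => // x [[? ?] []].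
  by rewrite mD20 mD adde0.
(* If [m A = 1], then [k A <= k setT = c m A], and [kgt] makes [A] null after all. *)
have mA0 : m A = 0%E.
  have [//|mA1] := erg A mA invA; apply: kgt => //.
  by rewrite mA1 mulr1; exact: (sub_mono sk).
have kle2 E : measurable E -> k E <= c * fine (m E).
  move=> mE; have mI : measurable (E `&` A) by exact: measurableI.
  have mDE : measurable (E `\` A) by exact: measurableD.
  have kI : k (E `&` A) <= 0.
    rewrite -lee_fin (le_trans (sub_le sk _))//.
    by rewrite -[leRHS]mA0 le_measure ?inE//.
  have -> : k E = k (E `\` A) + k (E `&` A).
    rewrite addrC -(subU sk)// ?setUIDK//.
    by apply/seteqP; split => // x [[_ ?] []].
  rewrite -[leRHS]addr0 lerD// (le_trans (kle _ mDE _))//.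
    by move=> x [_] /negP; rewrite -leNgt.
  by rewrite ler_wpM2l// fine_le ?fm// le_measure ?inE//.
(* The reverse inequality is [kle2] for the complement, because both sides have total mass [c]. *)
move=> E mE; apply/eqP; rewrite eq_le kle2//=.
have mC : measurable (~` E) by exact: measurableC.
have := kle2 _ mC; rewrite (sub_setC sk)//.
have /= -> := sub_setC (fine_submeasure m) mE.
by rewrite m1/= mulrBr mulr1 lerD2l lerN2.
Qed.

End ergodic_submeasure.

Lemma ergodic_submeasure (R : realType) d (Z : measurableType d)
    (m : {measure set Z -> \bar R}) (F : R -> Z -> Z) (k : set Z -> R) :
  m setT = 1%E -> (forall t, measurable_fun setT (F t)) ->
  flow_invariant m F -> ergodic m F -> submeasure m k ->
  (forall t A, measurable A -> k (F t @^-1` A) = k A) ->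
  forall A, measurable A -> k A = k setT * fine (m A).
Proof.
move=> m1; have [|m' m'E] := @measure_finite_pack _ _ _ m; first by rewrite m1 ltry.
by rewrite -m'E; apply: ergodic_submeasure_finite; rewrite m'E.
Qed.

(** * Induction over sigma-algebras, translation of Lebesgue measure, increasing unions *)

Lemma sigma_algebra_nondecreasing (T : Type) (P : set (set T)) : P set0 ->
  (forall A, P A -> P (~` A)) -> (forall A B, P A -> P B -> P (A `|` B)) ->
  (forall F : (set T)^nat, (forall n, P (F n)) -> nondecreasing_seq F ->
    P (\bigcup_n F n)) ->
  sigma_algebra setT P.
Proof.
move=> P0 PC PU Pnd; split => // [A /PC|A PA]; first by rewrite setTD.
rewrite -bigcup_bigsetU_bigcup; apply: Pnd => [n|n m nm].
  by elim/big_ind : _ => // i _; exact: PA.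
by apply/subsetPset; exact: (@subset_bigsetU _ A).
Qed.

Lemma measurable_prod_ind d1 d2 (T1 : measurableType d1) (T2 : measurableType d2)
    (P : set (set (T1 * T2))) : sigma_algebra setT P ->
  (forall A, measurable A -> P (fst @^-1` A)) ->
  (forall A, measurable A -> P (snd @^-1` A)) -> measurable `<=` P.
Proof.
move=> sP P1 P2; apply: smallest_sub => //.
by move=> _ [[A mA <-]|[A mA <-]]; rewrite setTI; [exact: P1|exact: P2].
Qed.

Lemma measurable_real_ind (R : realType) (P : set (set R)) :
  sigma_algebra setT P -> (forall x, P `]-oo, x[%classic) ->
  (measurable : set (set R)) `<=` P.
Proof.
move=> sP P1 A.
rewrite (_ : measurable A = (@RGenInftyO.G R).-sigma.-measurable A); last first.
  by rewrite -RGenInftyO.measurableE.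
by apply: smallest_sub => //= _ [x ->].
Qed.

Lemma sigma_algebra_preimage (T T' : Type) (f : T -> T') (P : set (set T)) :
  sigma_algebra setT P -> sigma_algebra setT [set A | P (f @^-1` A)].
Proof.
move=> [P0 PD PU]; split => /=; first by rewrite preimage_set0.
  by move=> A /PD; rewrite !setTD preimage_setC.
by move=> A PA; rewrite preimage_bigcup; exact: PU.
Qed.

Lemma lebesgue_measure_translate (R : realType) (s : R) (A : set R) :
  measurable A ->
  lebesgue_measure ((fun t => t + s) @^-1` A) = lebesgue_measure A.
Proof.
move=> mA; have ms : measurable_fun [set: R] (fun t => t + s).
  by apply: measurable_funD => //; exact: measurable_cst.
pose f (t : measurableTypeR R) : measurableTypeR R := t + s.
have mf : measurable_fun [set: measurableTypeR R] f by [].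
pose pf : {measure set (measurableTypeR R) -> \bar R} :=
  pushforward lebesgue_measure f.
apply/esym; apply: (@lebesgue_measure_unique R (pf mf)) => //.
move=> _ [[a b] _ <-]; rewrite /= /pushforward.
have -> : f @^-1` `]a, b]%classic = `]a - s, b - s]%classic.
  by apply/seteqP; split => t /=; rewrite /f !in_itv/= ltrBlDr lerBrDr.
rewrite !lebesgue_measure_itv/= !lte_fin ltrD2r; case: ifPn => // _.
by rewrite -!EFinB; congr EFin; ring.
Qed.

Lemma measure_bigcup_approx (R : realType) d (Z : measurableType d)
    (m : {measure set Z -> \bar R}) (F : (set Z)^nat) :
  (m (\bigcup_n F n) < +oo)%E -> (forall n, measurable (F n)) ->
  nondecreasing_seq F -> forall e : R, 0 < e ->
  exists n, (m (\bigcup_n F n `\` F n) <= e%:E)%E.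
Proof.
move=> moo mF ndF e e0; pose G n := \bigcup_n F n `\` F n.
have mUF : measurable (\bigcup_n F n) by exact: bigcupT_measurable.
have mG n : measurable (G n) by exact: measurableD.
have : m \o G @ \oo --> m (\bigcap_n G n).
  apply: nonincreasing_cvg_mu => //.
  - apply: le_lt_trans moo; apply: le_measure; rewrite ?inE//; exact: subDsetl.
  - exact: bigcapT_measurable.
  - by move=> n k nk; apply/subsetPset; apply: setDS; exact/subsetPset/ndF.
have -> : \bigcap_n G n = set0.
  rewrite -subset0 => x Gx; have [[n _ Fnx] _] := Gx 0%N I.
  by have [_] := Gx n I; exact.
rewrite measure0 => /fine_cvgP[Gfin /cvgrPdist_le /(_ _ e0) H].
have [n _ /(_ n (leqnn n)) [Gn1 Gn2]] := filterI Gfin H.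
exists n; rewrite -[leLHS]fineK// lee_fin.
by move: Gn2; rewrite sub0r normrN /=; apply: le_trans; exact: ler_norm.
Qed.

(** * Continuity of measure-preserving flows *)

Section flow_continuity.
Context {R : realType} d (X : measurableType d) (mu : probability X R).

Let U : measurableType _ := measurableTypeR R.
Let L : {measure set (X * U) -> \bar R} := (mu \x lebesgue_measure)%E.
Let shift (s : R) (p : X * U) : X * U := (p.1, p.2 + s).
Let XI (a b : R) : set (X * U) := snd @^-1` `[a, b]%classic.

Let measurable_shift s : measurable_fun [set: X * U] (shift s).
Proof.
apply: measurable_fun_pair => //=.
by apply: measurable_funD => //; exact: measurable_cst.
Qed.

Let measurable_preshift s D : measurable D -> measurable (shift s @^-1` D).
Proof. by move=> mD; rewrite -[X in measurable X]setTI; exact: measurable_shift. Qed.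

Let shiftE s D : measurable D -> L (shift s @^-1` D) = L D.
Proof.
move=> mD; apply: eq_integral => x _ /=.
rewrite -[RHS](lebesgue_measure_translate s); last exact: measurable_xsection.
by congr lebesgue_measure; rewrite !xsectionE.
Qed.

Let measurable_XI a b : measurable (XI a b).
Proof. by rewrite /XI -[X in measurable X]setTI; apply: measurable_snd. Qed.

Let L_XI a b : a <= b -> L (XI a b) = (b - a)%:E.
Proof.
move=> ab; rewrite (_ : XI a b = setT `*` `[a, b]%classic).
  rewrite [LHS]product_measure1E// [X in (X * _)%E](_ : _ = 1%E); last first.
    exact: probability_setT.
  rewrite mul1e [LHS](lebesgue_measure_itv `[a, b])/=.
  by rewrite lte_fin -EFinB; case: ltgtP ab => // ->; rewrite subrr.
by apply/seteqP; split => -[x t] //= [].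
Qed.

(* These sets form a sigma-algebra, and [D = [set p | A (T p.2 p.1)]] turns the
   property into continuity of the flow at [A]. *)
Let shift_continuous (D : set (X * U)) := measurable D /\
  forall e : R, 0 < e -> exists2 dl : R, 0 < dl & forall s, `|s| < dl ->
    (L (XI 0 1 `&` ((shift s @^-1` D) `+` D)) <= e%:E)%E.

Let measurable_sd s (D : set (X * U)) : measurable D ->
  measurable (XI 0 1 `&` ((shift s @^-1` D) `+` D)).
Proof.
move=> mD; apply: measurableI => //.
by apply: measurableU; apply: measurableD => //; exact: measurable_preshift.
Qed.

Let shift_continuousC D : shift_continuous D -> shift_continuous (~` D).
Proof.
move=> [mD cD]; split; first exact: measurableC.
move=> e /cD[dl dl0 H]; exists dl => // s /H; congr (L (_ `&` _) <= _)%E.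
by rewrite preimage_setC /setY !setDE !setCK setUC; congr (_ `|` _); rewrite setIC.
Qed.

Let shift_continuousU A B : shift_continuous A -> shift_continuous B ->
  shift_continuous (A `|` B).
Proof.
move=> [mA cA] [mB cB]; split; first exact: measurableU.
move=> e e0; have e20 : 0 < e / 2 by rewrite divr_gt0.
have [d1 d10 H1] := cA _ e20; have [d2 d20 H2] := cB _ e20.
exists (Num.min d1 d2); first by rewrite lt_min d10.
move=> s; rewrite lt_min => /andP[/H1 {}H1 /H2 {}H2].
rewrite (splitr e) EFinD (le_trans _ (leeD H1 H2))//.
rewrite (le_trans _ (measureU2 _ (measurable_sd s mA) (measurable_sd s mB)))//.
apply: le_measure; rewrite ?inE; first by apply: measurable_sd; exact: measurableU.
  by apply: measurableU; exact: measurable_sd.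
move=> x /= [Jx]; rewrite /setY/= => H.
case: H => -[H1' H2']; move: H1' H2'.
  move=> [] + /not_orP[? ?]; [left|right]; split => //; left; split => //.
move=> [] + /not_orP[? ?]; [left|right]; split => //; right; split => //.
Qed.

Let shift_continuous_bigcup (F : (set (X * U))^nat) :
  (forall n, shift_continuous (F n)) -> nondecreasing_seq F ->
  shift_continuous (\bigcup_n F n).
Proof.
move=> cF ndF; have mF n : measurable (F n) by have [] := cF n.
have mUF : measurable (\bigcup_n F n) by exact: bigcupT_measurable.
split => // e e0; have e30 : 0 < e / 3 by rewrite divr_gt0.
(* The tail is controlled on a larger slab: for [|s| < 1] a point over [[0, 1]] and its shift both
   lie over [[-1, 2]]. *)
pose G n := XI (-1) 2 `&` (\bigcup_n F n `\` F n).
have mG n : measurable (G n) by apply: measurableI => //; exact: measurableD.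
have [n Gn] : exists n, (L (G n) <= (e / 3)%:E)%E.
  have mXF n : measurable (XI (-1) 2 `&` F n) by exact: measurableI.
  have ndXF : nondecreasing_seq (fun n => XI (-1) 2 `&` F n).
    by move=> n m nm; apply/subsetPset; apply: setIS; exact/subsetPset/ndF.
  have [|n Ln] := measure_bigcup_approx (m := L) _ mXF ndXF e30.
    apply: (@le_lt_trans _ _ (L (XI (-1) 2))); last by rewrite L_XI ?ltry//; lra.
    apply: le_measure; rewrite ?inE//; first exact: bigcupT_measurable.
    by move=> z [? _ []].
  exists n; apply: le_trans Ln; apply: le_measure; rewrite ?inE//.
    by apply: measurableD => //; exact: bigcupT_measurable.
  by move=> z [Xz [[k _ Fk] nF]]; split => [|[]//]; exists k.
have [_ /(_ _ e30)[dl dl0 H]] := cF n.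
exists (Num.min 1 dl); first by rewrite lt_min ltr01.
move=> s; rewrite lt_min => /andP[s1 /H {}H].
have -> : e = e / 3 + e / 3 + e / 3 by field.
rewrite !EFinD (le_trans _ (leeD (leeD H Gn) Gn))//.
rewrite -[in X in (_ <= _ + X)%E](shiftE s)//.
have mS : measurable (shift s @^-1` G n) by exact: measurable_preshift.
have mU := measurableU _ _ (measurable_sd s (mF n)) (mG n).
rewrite (le_trans _ (leeD2r _ (measureU2 _ (measurable_sd s (mF n)) (mG n))))//.
rewrite (le_trans _ (measureU2 _ mU mS))//.
apply: le_measure; rewrite ?inE; [exact: measurable_sd|exact: measurableU|].
move=> [x t] /= [Jt].
have J2t : XI (-1) 2 (x, t).
  by move: Jt; rewrite /XI/= !in_itv/= => /andP[? ?]; apply/andP; split; lra.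
have J2ts : XI (-1) 2 (shift s (x, t)).
  move: Jt s1; rewrite /XI/= !in_itv/= ltr_norml => /andP[? ?] /andP[? ?].
  by apply/andP; split; lra.
have [Fs|nFs] := pselect (F n (shift s (x, t)));
  have [Ft|nFt] := pselect (F n (x, t)).
- by case=> -[_ []]; exists n.
- by left; left; split => //; left.
- by left; left; split => //; right.
- by case=> -[? ?]; [right|left; right].
Qed.

Let shift_continuous_algebra : sigma_algebra setT shift_continuous.
Proof.
apply: sigma_algebra_nondecreasing => //.
split; first exact: measurable0.
move=> e e0; exists 1 => // s _.
by rewrite preimage_set0 setYK setI0 measure0 lee_fin ltW.
Qed.

Let measurable_shift_continuous D : measurable D -> shift_continuous D.
Proof.
move: D; apply: (measurable_prod_ind shift_continuous_algebra) => [C mC|].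
  split; first by rewrite -[X in measurable X]setTI; apply: measurable_fst.
  move=> e e0; exists 1 => // s _.
  by rewrite (_ : shift s @^-1` _ = fst @^-1` C)// setYK setI0 measure0 lee_fin ltW.
apply: measurable_real_ind; first exact/sigma_algebra_preimage.
move=> c /=; split; first by rewrite -[X in measurable X]setTI; apply: measurable_snd.
move=> e e0; exists (e / 2); first by rewrite divr_gt0.
(* A half-space and its shift differ only in the strip of heights within [e / 2] of [c]. *)
move=> s se; have -> : e = (c + e / 2) - (c - e / 2) by field.
rewrite -L_XI; last lra.
apply: le_measure; rewrite ?inE//.
  by apply: measurable_sd; rewrite -[X in measurable X]setTI; apply: measurable_snd.
move=> [x t] /= [_]; move: se; rewrite ltr_norml => /andP[? ?].
rewrite /setY/= /XI/= !in_itv/= => -[[? /negP]|[? /negP]]; rewrite -leNgt => ?;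
  apply/andP; split; lra.
Qed.

(** Joint measurability is enough. At height [t], the difference between [D] and its shift by [s] is
    the preimage under [T t] of the difference between [A] and its preimage under [T s]. By
    invariance all these slices have the same measure, and the slab has length 1, so the [L]-measure
    is exactly the quantity to be bounded. *)
Lemma flow_continuous (T : R -> X -> X) (A : set X) : mp_flow mu T ->
  measurable A -> forall e : R, 0 < e -> exists2 dl : R, 0 < dl &
    forall s, `|s| < dl -> fine (mu ((T s @^-1` A) `+` A)) <= e.
Proof.
move=> fT mA e e0.
pose D : set (X * U) := [set p | A (T p.2 p.1)].
have mD : measurable D.
  have mg : measurable_fun [set: X * U] (fun p => (p.2 : R, p.1)).
    exact: measurable_fun_pair.
  by rewrite -[D]setTI; apply: (measurableT_comp (measurable_flow fT) mg).
have [_ /(_ _ e0)[dl dl0 H]] := measurable_shift_continuous mD.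
exists dl => // s /H; rewrite -lee_fin.
have mT t B : measurable B -> measurable (T t @^-1` B).
  by move=> mB; rewrite -[X in measurable X]setTI; apply: (measurable_flow_at fT).
have mTA : measurable ((T s @^-1` A) `+` A).
  by apply: measurableU; apply: measurableD => //; exact: mT.
rewrite fineK ?fin_num_measure//; apply: le_trans.
set E := XI 0 1 `&` _; have mE : measurable E by exact: measurable_sd.
(* Fubini: [L] is computed from sections at fixed [x], while invariance shows on sections at fixed
   time. *)
have -> : L E = (mu \x^ lebesgue_measure)%E E.
  apply: product_measure_unique; last exact: mE.
  by move=> A1 A2 mA1 mA2; exact: product_measure2E.
set w := mu _.
suff -> : (mu \x^ lebesgue_measure)%E E = w by [].
transitivity (\int[lebesgue_measure]_(t in (`[0%R, 1%R]%classic : set U)) cst w t)%E.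
  rewrite integral_mkcond; apply: eq_integral => t _; rewrite patchE /=.
  have [/set_mem t01|/negP t01] := boolP (t \in _).
    rewrite /w -(flow_preserving fT t mTA); congr (mu _).
    rewrite ysectionE; apply/seteqP; split => x /=.
      by move=> [_]; rewrite /setY/= /D/= (addrC t) !(flowD fT).
    by rewrite /E/= /setY/= /D/= (addrC t) !(flowD fT).
  rewrite [X in mu X](_ : _ = set0) ?measure0// -subset0 => x.
  by rewrite ysectionE => -[/= Jt _]; apply: t01; exact/mem_set.
rewrite integral_cst//= [X in (_ * X)%E](lebesgue_measure_itv `[0, 1])/=.
by rewrite lte01 sube0 mule1.
Qed.

End flow_continuity.

(** * Compact inner regularity in the plane *)

Section plane_regularity.
Context {R : realType} (P : probability (R * R)%type R).

Let inner (A : set (R * R)) := measurable A /\ forall e : R, 0 < e ->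
  exists C : set (R * R), [/\ closed C, measurable C, C `<=` A & (P (A `\` C) <= e%:E)%E].

Let inner_closed (C : set (R * R)) : closed C -> measurable C -> inner C.
Proof.
move=> cC mC; split => // e e0; exists C; split => //.
by rewrite setDv measure0 lee_fin ltW.
Qed.

Let innerU A B : inner A -> inner B -> inner (A `|` B).
Proof.
move=> [mA iA] [mB iB]; split; first exact: measurableU.
move=> e e0; have e20 : 0 < e / 2 by rewrite divr_gt0.
have [C [cC mC CA PC]] := iA _ e20; have [D [cD mD DB PD]] := iB _ e20.
have mAC : measurable (A `\` C) by exact: measurableD.
have mBD : measurable (B `\` D) by exact: measurableD.
exists (C `|` D); split; [exact: closedU|exact: measurableU|exact: setUSS|].
rewrite (splitr e) EFinD (le_trans _ (leeD PC PD))//.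
rewrite (le_trans _ (measureU2 _ mAC mBD))//; apply: le_measure; rewrite ?inE.
- by apply: measurableD; exact: measurableU.
- exact: measurableU.
- by move=> x [[Ax|Bx]] /not_orP[? ?]; [left|right].
Qed.

Let inner_bigcap (F : (set (R * R))^nat) : (forall n, inner (F n)) ->
  inner (\bigcap_n F n).
Proof.
move=> iF; have mF n : measurable (F n) by have [] := iF n.
have mIF : measurable (\bigcap_n F n) by exact: bigcapT_measurable.
split => // e e0.
have /choice[C HC] n : exists C : set (R * R), [/\ closed C,
    measurable C, C `<=` F n & (P (F n `\` C) <= (e / (2 ^ n.+1)%:R)%:E)%E].
  by have [_] := iF n; apply; rewrite divr_gt0// ltr0n expn_gt0.
exists (\bigcap_n C n); split.
- by apply: closed_bigI => n _; have [] := HC n.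
- by apply: bigcapT_measurable => n; have [] := HC n.
- by move=> x Cx n _; have [_ _ + _] := HC n; apply; exact: Cx.
have mD n : measurable (F n `\` C n).
  by have [_ ? _ _] := HC n; exact: measurableD.
apply: (@le_trans _ _ (\sum_(n <oo) P (F n `\` C n))%E); last first.
  apply: (@le_trans _ _ (\sum_(n <oo) (e / (2 ^ n.+1)%:R)%:E)%E).
    by apply: lee_nneseries => n // _; have [] := HC n.
  exact/epsilon_trick0/ltW.
apply: measure_sigma_subadditive => //.
  by apply: measurableD => //; apply: bigcapT_measurable => n; have [] := HC n.
move=> x [Fx /existsNP[n /not_implyP[_ nCx]]]; exists n => //; split => //; exact: Fx.
Qed.

(** An infinite union of closed sets need not be closed, so the union is cut at one stage [n], which
    loses at most [e / 2]. *)
Let inner_bigcup (F : (set (R * R))^nat) : (forall n, inner (F n)) ->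
  nondecreasing_seq F -> inner (\bigcup_n F n).
Proof.
move=> iF ndF; have mF n : measurable (F n) by have [] := iF n.
have mUF : measurable (\bigcup_n F n) by exact: bigcupT_measurable.
split => // e e0; have e20 : 0 < e / 2 by rewrite divr_gt0.
have [|n Pn] := measure_bigcup_approx (m := P) _ mF ndF e20.
  by rewrite ltey_eq fin_num_measure.
have [_ /(_ _ e20)[C [cC mC CF PC]]] := iF n.
exists C; split => //; first by apply: subset_trans CF _; exact: bigcup_sup.
have m1 : measurable (\bigcup_n F n `\` F n) by exact: measurableD.
have m2 : measurable (F n `\` C) by exact: measurableD.
rewrite (splitr e) EFinD (le_trans _ (leeD Pn PC))//.
rewrite (le_trans _ (measureU2 _ m1 m2))//; apply: le_measure; rewrite ?inE.
- exact: measurableD.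
- exact: measurableU.
- by move=> x [Ux nCx]; have [Fx|nFx] := pselect (F n x); [right|left].
Qed.

(** Approximation from inside does not pass to complements by itself; asking it of both sets makes
    the class a sigma-algebra. *)
Let inner2 A := inner A /\ inner (~` A).

Let inner2_sigma_algebra : sigma_algebra setT inner2.
Proof.
apply: sigma_algebra_nondecreasing.
- by rewrite /inner2 setC0; split; apply: inner_closed; [exact: closed0|exact: measurable0|exact: closedT|exact: measurableT].
- by move=> A [? ?]; rewrite /inner2 setCK.
- move=> A B [iA iA'] [iB iB']; split; first exact: innerU.
  rewrite setCU -bigcap2E; apply: inner_bigcap => -[|[|n]] //=.
  by apply: inner_closed; [exact: closedT|exact: measurableT].
- move=> F iF ndF; split; first by apply: inner_bigcup => // n; have [] := iF n.
  by rewrite setC_bigcup; apply: inner_bigcap => n; have [] := iF n.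
Qed.

(** The complement is closed, and the open half-plane is an increasing union of closed ones. *)
Let inner2_halfplane (f : R * R -> R) x : continuous f ->
  measurable_fun setT f -> inner2 (f @^-1` `]-oo, x[%classic).
Proof.
move=> cf mf; split; last first.
  apply: inner_closed; last first.
    by apply: measurableC; rewrite -[X in measurable X]setTI; exact: mf.
  rewrite preimage_setC (_ : ~` _ = [set y | x <= y]).
    by apply: preimage_closed => //; exact: closed_ge.
  by apply/seteqP; split => y; rewrite /= in_itv/= leNgt => /negP.
rewrite (_ : _ @^-1` _ =
    \bigcup_n (f @^-1` `]-oo, (x - n.+1%:R^-1)]%classic)).
  apply: inner_bigcup => [n|n m nm].
    apply: inner_closed; last first.
      by rewrite -[X in measurable X]setTI; exact: mf.
    by apply: preimage_closed; [|exact: interval_closed].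
  apply/subsetPset => y; rewrite /= !in_itv/= => /le_trans; apply.
  by rewrite lerD2l lerN2 lef_pV2 ?posrE// ler_nat.
rewrite -preimage_bigcup; congr (_ @^-1` _).
apply/seteqP; split => y; rewrite /= in_itv/=; last first.
  by move=> [n _ /=]; rewrite in_itv/= => /le_lt_trans; apply; rewrite ltrBlDr ltrDl invr_gt0.
move=> yx; exists (Num.truncn (x - y)^-1) => //=.
rewrite in_itv/= lerBrDr -lerBrDl invf_ple ?posrE ?subr_gt0//.
by rewrite ltW// truncnS_gt.
Qed.

Lemma plane_compact_regular (A : set (R * R)) : measurable A ->
  forall e : R, 0 < e -> exists K : set (R * R), [/\ compact K, measurable K, K `<=` A &
    (P (A `\` K) <= e%:E)%E].
Proof.
move=> mA e e0; have e20 : 0 < e / 2 by rewrite divr_gt0.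
have [iA _] : inner2 A.
  have cfst : continuous (@fst R R) by move=> p; exact: cvg_fst.
  have csnd : continuous (@snd R R) by move=> p; exact: cvg_snd.
  move: A mA; apply: (measurable_prod_ind inner2_sigma_algebra).
    apply: measurable_real_ind; first exact/sigma_algebra_preimage.
    by move=> x; exact: inner2_halfplane.
  apply: measurable_real_ind; first exact/sigma_algebra_preimage.
  by move=> x; exact: inner2_halfplane.
have [_ /(_ _ e20)[C [cC mC CA PC]]] := iA.
(* Cutting with a large square, which carries almost all of [P], turns the closed set into a compact
   one. *)
pose I n : set R := `[- n%:R, n%:R]%classic.
pose F n := I n `*` I n.
have mF n : measurable (F n) by apply: measurableX; exact: measurable_itv.
have UF : \bigcup_n F n = setT.
  apply/seteqP; split => // -[x y] _.
  exists (maxn (Num.truncn `|x|).+1 (Num.truncn `|y|).+1) => //.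
  split; rewrite /I/= in_itv/= -ler_norml (le_trans (ltW (truncnS_gt _)))// ler_nat.
    exact: leq_maxl.
  exact: leq_maxr.
have ndF : nondecreasing_seq F.
  move=> n m nm; apply/subsetPset => -[x y]; rewrite /F/I/= !in_itv/= -!ler_norml.
  by move=> [xn yn]; split; [apply: le_trans xn _|apply: le_trans yn _]; rewrite ler_nat.
have [|n] := measure_bigcup_approx (m := P) _ mF ndF e20.
  by rewrite UF -ge0_fin_numE ?fin_num_measure.
rewrite UF => Pn; exists (F n `&` C); split.
- by apply: compact_closedI => //; apply: compact_setX; exact: segment_compact.
- exact: measurableI.
- by move=> x [_ /CA].
have m1 : measurable (setT `\` F n) by exact: measurableD.
have m2 : measurable (A `\` C) by exact: measurableD.
rewrite (splitr e) EFinD (le_trans _ (leeD Pn PC))//.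
rewrite (le_trans _ (measureU2 _ m1 m2))//; apply: le_measure; rewrite ?inE.
- by apply: measurableD => //; exact: measurableI.
- exact: measurableU.
- by move=> x [Ax /not_andP[?|?]]; [left|right].
Qed.

End plane_regularity.

(** * Weak mixing in mean *)

Lemma measurable_flow_preimage (R : realType) d (X : measurableType d)
    (mu : set X -> \bar R) (T : R -> X -> X) t (A : set X) :
  mp_flow mu T -> measurable A -> measurable (T t @^-1` A).
Proof.
by move=> fT mA; rewrite -[X in measurable X]setTI; apply: (measurable_flow_at fT).
Qed.

Section prod_flow.
Context {R : realType} dX dY (X : measurableType dX) (Y : measurableType dY).
Context (mu : probability X R) (nu : probability Y R).
Context (T : R -> X -> X) (S : R -> Y -> Y).
Context (fT : mp_flow mu T) (fS : mp_flow nu S).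

Lemma measurable_prod_flow t : measurable_fun [set: X * Y] (prod_flow T S t).
Proof.
apply: measurable_fun_pair.
  exact: (measurableT_comp (measurable_flow_at fT t) measurable_fst).
exact: (measurableT_comp (measurable_flow_at fS t) measurable_snd).
Qed.

Lemma measurable_prod_flow_preimage t C : measurable C ->
  measurable (prod_flow T S t @^-1` C).
Proof.
by move=> mC; rewrite -[X in measurable X]setTI; exact: measurable_prod_flow.
Qed.

Lemma prod_flow_preimageX t A B :
  prod_flow T S t @^-1` (A `*` B) = (T t @^-1` A) `*` (S t @^-1` B).
Proof. by []. Qed.

Lemma prod_flow_preimageD s t C :
  prod_flow T S t @^-1` (prod_flow T S s @^-1` C) = prod_flow T S (t + s) @^-1` C.
Proof.
apply/seteqP; split => -[x y]; rewrite /prod_flow/= addrC (flowD fT) (flowD fS)//.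
Qed.

Lemma prod_flow_invariant : flow_invariant (mu \x nu)%E (prod_flow T S).
Proof.
move=> t C mC; pose pf : {measure set (X * Y) -> \bar R} :=
  pushforward (mu \x nu)%E (prod_flow T S t).
apply/esym; apply: (@product_measure_unique _ _ X Y R mu nu (pf (measurable_prod_flow t))) => //.
move=> A B mA mB; 
transitivity ((mu \x nu)%E ((T t @^-1` A) `*` (S t @^-1` B))); first by [].
rewrite [LHS]product_measure1E; [|exact: (measurable_flow_preimage t fT)|
  exact: (measurable_flow_preimage t fS)].
by congr (_ * _)%E; [exact: (flow_preserving fT)|exact: (flow_preserving fS)].
Qed.

End prod_flow.

Lemma product_probability_setT (R : realType) dX dY (X : measurableType dX)
    (Y : measurableType dY) (mu : probability X R) (nu : probability Y R) :
  (mu \x nu)%E [set: X * Y] = 1%E.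
Proof.
rewrite -setXTT [LHS]product_measure1E//.
by rewrite -[RHS]mule1; congr (_ * _)%E; exact: probability_setT.
Qed.

Section weak_mixing_mean.
Context {R : realType} d (Y : measurableType d) (nu : probability Y R).
Context (S : R -> Y -> Y) (fS : mp_flow nu S) (wS : weakly_mixing nu S).
Context (M : (R -> R) -> R) (MM : invariant_mean M).

(* [C |-> M_t (k \x k) ((S_t \x S_t)^-1 C)] is an invariant submeasure of
   [nu \x nu], hence a multiple of it. *)
Lemma weak_mixing_mean (k : set Y -> R) (B : set Y) : submeasure nu k ->
  measurable B ->
  M (fun t => (k (S t @^-1` B) - k setT * fine (nu B)) ^+ 2) = 0.
Proof.
move=> sk mB; have [K KE] := submeasure_measure sk.
have mSB t : measurable (S t @^-1` B) by exact: (measurable_flow_preimage t fS).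
pose PK : {measure set (Y * Y) -> \bar R} := (K \x K)%E.
have KX A1 A2 : measurable A1 -> measurable A2 ->
    PK (A1 `*` A2) = (k A1 * k A2)%:E.
  move=> m1 m2; rewrite [LHS]product_measure1E// EFinM.
  by congr (_ * _)%E; exact: KE.
(* [K <= nu] is used twice: on the sections, and on the measure that integrates them. *)
have Kle C : measurable C -> (PK C <= (nu \x nu) C)%E.
  move=> mC; apply: (@le_trans _ _ (\int[K]_x (nu \o xsection C) x)%E).
    apply: ge0_le_integral => //.
    - exact: measurable_fun_xsection.
    - exact: measurable_fun_xsection.
    - move=> x _ /=; have mx : measurable (xsection C x) by exact: measurable_xsection.
      by rewrite KE//; exact: (sub_le sk).
  apply: ge0_le_measure_integral => //.
  - by move=> A mA; have := sub_le sk mA; rewrite -KE.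
  - exact: measurable_fun_xsection.
have NT := product_probability_setT nu nu.
have Nfin C : measurable C -> ((nu \x nu) C <= 1)%E.
  by move=> mC; rewrite -NT; apply: le_measure; rewrite ?inE.
have Kfin C : measurable C -> PK C \is a fin_num.
  move=> mC; rewrite ge0_fin_numE// (le_lt_trans (Kle _ mC))//.
  by rewrite (le_lt_trans (Nfin _ mC))// ltry.
pose v C t := fine (PK (prod_flow S S t @^-1` C)).
have mF t C : measurable C -> measurable (prod_flow S S t @^-1` C).
  exact: (measurable_prod_flow_preimage fS fS).
have v01 C : measurable C -> forall t, 0 <= v C t <= 1.
  move=> mC t; rewrite fine_ge0//= -lee_fin fineK; last by apply: Kfin; exact: mF.
  by rewrite (le_trans (Kle _ (mF t _ mC)))// Nfin//; exact: mF.
have bv C : measurable C -> bounded_family (v C).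
  by move=> mC; exact: bounded_family_itv (v01 C mC).
pose kk C := M (v C).
have skk : submeasure (nu \x nu)%E kk.
  split => [C mC|C D mC mD CD|C mC].
  - by apply: (mean_ge0 MM (bv _ mC)) => t; have /andP[] := v01 C mC t.
  - rewrite /kk -(meanD MM); [|exact: bv|exact: bv].
    congr M; apply/funext => t; rewrite /v preimage_setU.
    have mC' := mF t _ mC; have mD' := mF t _ mD.
    rewrite measureU//; last by rewrite -preimage_setI CD preimage_set0.
    by rewrite fineD//; exact: Kfin.
  - have NCfin : (nu \x nu)%E C \is a fin_num.
      by rewrite ge0_fin_numE// (le_lt_trans (Nfin _ mC))// ltry.
    rewrite -[leRHS]fineK// lee_fin -[leRHS](mean_cst MM).
    apply: (mean_le MM); [exact: bv|exact: bounded_family_cst|move=> t].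
    rewrite /v fine_le//; first by apply: Kfin; exact: mF.
    by rewrite -(prod_flow_invariant fS fS t mC) Kle//; exact: mF.
have invkk t C : measurable C -> kk (prod_flow S S t @^-1` C) = kk C.
  move=> mC; rewrite -[RHS](mean_shift MM t); last exact: bv.
  by congr M; apply/funext => s; rewrite /v (prod_flow_preimageD fS fS).
have E := ergodic_submeasure (m := (nu \x nu)%E) NT
  (measurable_prod_flow fS fS) (prod_flow_invariant fS fS) wS skk invkk.
pose c := k setT; pose b := fine (nu B); pose u t := k (S t @^-1` B).
have kkT : kk setT = c * c.
  rewrite -[RHS](mean_cst MM); congr M; apply/funext => t.
  by rewrite /v preimage_setT -setXTT KX.
have bu : bounded_family u.
  apply: (@bounded_family_itv _ _ _ 0 c) => t; rewrite (sub_ge0 sk)//.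
  exact: (sub_mono sk).
have EBB : M (fun t => u t * u t) = c * c * (b * b).
  rewrite -kkT -fineM ?fin_num_measure// -[X in fine X]product_measure1E// -E.
    by congr M; apply/funext => t; rewrite /v prod_flow_preimageX KX.
  exact: measurableX.
(* The factor [c] is kept because it may be 0; the cross term of the square contains it anyway. *)
have EBT : c * M u = c * c * b.
  have mBT : measurable (B `*` [set: Y]) by exact: measurableX.
  rewrite -(meanZ MM)// -kkT; have -> : b = fine ((nu \x nu)%E (B `*` setT)).
    rewrite [X in fine X]product_measure1E// [X in (_ * X)%E](_ : _ = 1%E) ?mule1//.
    exact: probability_setT.
  rewrite -E//; congr M; apply/funext => t.
  by rewrite /v prod_flow_preimageX preimage_setT KX// mulrC.
rewrite -/c -/b (_ : (fun t => _) =
  (fun t => (u t * u t + - (2 * b * c) * u t) + (c * b) ^+ 2)); last first.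
  by apply/funext => t; rewrite /u; ring.
have buu := bounded_familyM bu bu.
have b1 := bounded_familyZ (- (2 * b * c)) bu; have b2 := bounded_familyD buu b1.
rewrite (meanD MM b2 (bounded_family_cst _)) (meanD MM buu b1) (meanZ MM _ bu).
rewrite (mean_cst MM) EBB.
rewrite (_ : - (2 * b * c) * M u = - (2 * b) * (c * M u)); last by ring.
by rewrite EBT; ring.
Qed.

End weak_mixing_mean.

(** * Bijoinings and their extremal elements *)

Section submeasure_extra.
Context {R : realType} d (Z : measurableType d).

Lemma sub_dist (m : set Z -> \bar R) (k : set Z -> R) A B : submeasure m k ->
  measurable A -> measurable B -> `|k A - k B| <= k (A `+` B).
Proof.
move=> sk mA mB.
have mAB : measurable (A `\` B) by exact: measurableD.
have mBA : measurable (B `\` A) by exact: measurableD.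
have mY : measurable (A `+` B) by exact: measurableU.
have H C D : measurable C -> measurable D -> C `\` D `<=` A `+` B ->
    k C - k D <= k (A `+` B).
  move=> mC mD CD; rewrite lerBlDr (le_trans _ (sub_subadd sk mY mD))//.
  apply: (sub_mono sk) => //; first exact: measurableU.
  by move=> x Cx; have [|nDx] := pselect (D x); [right|left; exact: CD].
rewrite ler_norml lerNl opprB !H//.
- by move=> x; left.
- by move=> x; right.
Qed.

Lemma flow_symdiff_le (m : probability Z R) (F : R -> Z -> Z) (A : set Z) :
  mp_flow m F -> measurable A -> forall e : R, 0 < e ->
  exists2 dl : R, 0 < dl & forall s t, `|s - t| < dl ->
    (m ((F s @^-1` A) `+` (F t @^-1` A)) <= e%:E)%E.
Proof.
move=> fF mA e e0; have [dl dl0 H] := flow_continuous fF mA e0.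
exists dl => // s t /H {}H.
have mF u C : measurable C -> measurable (F u @^-1` C).
  exact: (measurable_flow_preimage u fF).
have mY u : measurable ((F u @^-1` A) `+` A).
  by apply: measurableU; apply: measurableD => //; exact: mF.
rewrite (_ : F s @^-1` A `+` F t @^-1` A = F t @^-1` (F (s - t) @^-1` A `+` A)).
  by rewrite (flow_preserving fF)// -[leLHS]fineK ?fin_num_measure.
by apply/seteqP; split => x; rewrite /setY/= -(flowD fF) subrK.
Qed.

Lemma flow_submeasure_continuous (m : probability Z R) (F : R -> Z -> Z)
    (k : set Z -> R) (A : set Z) : mp_flow m F -> submeasure m k ->
  measurable A -> forall e : R, 0 < e -> exists2 dl : R, 0 < dl &
    forall s t, `|s - t| < dl -> `|k (F s @^-1` A) - k (F t @^-1` A)| <= e.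
Proof.
move=> fF sk mA e e0; have [dl dl0 H] := flow_symdiff_le fF mA e0.
exists dl => // s t /H {}H.
have mF u : measurable (F u @^-1` A) by exact: (measurable_flow_preimage u fF).
rewrite (le_trans (sub_dist sk (mF s) (mF t)))// -lee_fin (le_trans _ H)//.
by apply: (sub_le sk); apply: measurableU; exact: measurableD.
Qed.

End submeasure_extra.

(** Ergodicity of the square is applied to the cylinder over [A], which has the mass of [A] and
    inherits its invariance. *)
Lemma weakly_mixing_ergodic (R : realType) d (X : measurableType d)
    (mu : probability X R) (T : R -> X -> X) : mp_flow mu T ->
  weakly_mixing mu T -> ergodic mu T.
Proof.
move=> fT wT A mA A0.
have AX C : measurable C -> (mu \x mu)%E (C `*` [set: X]) = mu C.
  move=> mC; rewrite [LHS]product_measure1E// -[RHS]mule1.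
  by congr (_ * _)%E; exact: probability_setT.
rewrite -AX//; apply: wT => [|t]; first exact: measurableX.
rewrite prod_flow_preimageX preimage_setT.
rewrite (_ : _ `+` _ = ((T t @^-1` A) `+` A) `*` [set: X]).
  rewrite AX//; apply: measurableU; apply: measurableD => //;
    exact: (measurable_flow_preimage t fT).
apply/seteqP; split => -[x y]; rewrite /setY/=.
  by move=> [[[? _] /not_andP[//|//]]|[[? _] /not_andP[//|//]]]; split => //; [left|right].
by move=> [[[? ?]|[? ?]] _]; [left|right]; split => // -[].
Qed.

Record biadditive (R : realType) d1 d2 (Z1 : measurableType d1)
    (Z2 : measurableType d2) (b : set Z1 -> set Z2 -> R) : Prop := Biadditive {
  bi_ge0 : forall A B, measurable A -> measurable B -> 0 <= b A B ;
  bi_Ul : forall A A' B, measurable A -> measurable A' -> measurable B ->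
    A `&` A' = set0 -> b (A `|` A') B = b A B + b A' B ;
  bi_Ur : forall A B B', measurable A -> measurable B -> measurable B' ->
    B `&` B' = set0 -> b A (B `|` B') = b A B + b A B' }.

Section biadditive.
Context {R : realType} d1 d2 (Z1 : measurableType d1) (Z2 : measurableType d2).
Implicit Types b : set Z1 -> set Z2 -> R.

(** The dominating set function is the function itself: this opens the finitely additive calculus in
    one variable with the other fixed. *)
Lemma biadditive_left b B : biadditive b -> measurable B ->
  submeasure (fun A => (b A B)%:E) (b^~ B).
Proof.
move=> bb mB; split => //.
- by move=> A mA; exact: (bi_ge0 bb).
- by move=> A A' mA mA' AA'; exact: (bi_Ul bb).
Qed.

Lemma biadditive_right b A : biadditive b -> measurable A ->
  submeasure (fun B => (b A B)%:E) (b A).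
Proof.
move=> bb mA; split => //.
- by move=> B mB; exact: (bi_ge0 bb).
- by move=> B B' mB mB' BB'; exact: (bi_Ur bb).
Qed.

Lemma bi_mono b A A' B B' : biadditive b -> measurable A -> measurable A' ->
  measurable B -> measurable B' -> A `<=` A' -> B `<=` B' -> b A B <= b A' B'.
Proof.
move=> bb mA mA' mB mB' AA' BB'.
rewrite (le_trans (sub_mono (biadditive_left bb mB) mA mA' AA'))//.
exact: (sub_mono (biadditive_right bb mA')).
Qed.

Lemma biadditive_mean (I : Type) (M : (I -> R) -> R)
    (b : I -> set Z1 -> set Z2 -> R) : mean_functional M ->
  (forall i, biadditive (b i)) ->
  (forall A B, measurable A -> measurable B -> bounded_family (fun i => b i A B)) ->
  biadditive (fun A B => M (fun i => b i A B)).
Proof.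
move=> MM bb bnd; split => [A B mA mB|A A' B mA mA' mB AA'|A B B' mA mB mB' BB'].
- by apply: (mean_ge0 MM) => [|i]; [exact: bnd|exact: bi_ge0].
- rewrite -(meanD MM); [|exact: bnd|exact: bnd].
  by congr M; apply/funext => i; rewrite (bi_Ul (bb i)).
- rewrite -(meanD MM); [|exact: bnd|exact: bnd].
  by congr M; apply/funext => i; rewrite (bi_Ur (bb i)).
Qed.

Lemma biadditive_bounded (I : Type) (b : I -> set Z1 -> set Z2 -> R) (c : R) A B :
  (forall i, biadditive (b i)) -> (forall i, b i setT setT <= c) ->
  measurable A -> measurable B -> bounded_family (fun i => b i A B).
Proof.
move=> bb bc mA mB; apply: (@bounded_family_itv _ _ _ 0 c) => i.
rewrite (bi_ge0 (bb i))//= (le_trans _ (bc i))//.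
by apply: (bi_mono (bb i)).
Qed.

End biadditive.

Section bijoining.
Context {R : realType} dX dY (X : measurableType dX) (Y : measurableType dY).
Context (mu : probability X R) (nu : probability Y R).
Context (T : R -> X -> X) (S : R -> Y -> Y).
Context (fT : mp_flow mu T) (fS : mp_flow nu S).
Context (eT : ergodic mu T) (eS : ergodic nu S).
Implicit Types b th : set X -> set Y -> R.

Record bijoining b : Prop := Bijoining {
  bij_add :> biadditive b ;
  bij_l : forall A, measurable A -> b A setT = fine (mu A) ;
  bij_r : forall B, measurable B -> b setT B = fine (nu B) ;
  bij_inv : forall t A B, measurable A -> measurable B ->
    b (T t @^-1` A) (S t @^-1` B) = b A B }.

(** An invariant piece of [b], of any mass. Such pieces arise by restricting the coupling to the
    part above two sets of the plane. *)
Record subjoining b th : Prop := Subjoining {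
  sj_add :> biadditive th ;
  sj_le : forall A B, measurable A -> measurable B -> th A B <= b A B ;
  sj_inv : forall t A B, measurable A -> measurable B ->
    th (T t @^-1` A) (S t @^-1` B) = th A B }.

Lemma bijoining_setTT b : bijoining b -> b setT setT = 1.
Proof. by move=> jb; rewrite (bij_l jb)// probability_setT. Qed.

Lemma bijoining_submeasure_r b A : bijoining b -> measurable A ->
  submeasure nu (b A).
Proof.
move=> jb mA; split => [B mB|B B' mB mB' BB'|B mB].
- exact: (bi_ge0 jb).
- exact: (bi_Ur jb).
- rewrite -[leRHS]fineK ?fin_num_measure// lee_fin -(bij_r jb)//.
  exact: (bi_mono jb).
Qed.

Lemma subjoining_submeasure_l b th : bijoining b -> subjoining b th ->
  submeasure mu (th^~ setT).
Proof.
move=> jb jth; split => [A mA|A A' mA mA' AA'|A mA].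
- exact: (bi_ge0 jth).
- exact: (bi_Ul jth).
- rewrite -[leRHS]fineK ?fin_num_measure// lee_fin -(bij_l jb)//.
  exact: (sj_le jth).
Qed.

Lemma subjoining_submeasure_r b th A : bijoining b -> subjoining b th ->
  measurable A -> submeasure nu (th A).
Proof.
move=> jb jth mA; split => [B mB|B B' mB mB' BB'|B mB].
- exact: (bi_ge0 jth).
- exact: (bi_Ur jth).
- rewrite -[leRHS]fineK ?fin_num_measure// lee_fin -(bij_r jb)//.
  rewrite (le_trans (sj_le jth _ _))//; exact: (bi_mono jb).
Qed.

(** The marginal is an invariant submeasure of [mu], so ergodicity makes it a multiple of [mu]. *)
Lemma subjoining_l b th A : bijoining b -> subjoining b th -> measurable A ->
  th A setT = th setT setT * fine (mu A).
Proof.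
move=> jb jth; have sth := subjoining_submeasure_l jb jth.
apply: (ergodic_submeasure (probability_setT mu) _ (flow_preserving fT) eT sth).
  exact: (measurable_flow_at fT).
by move=> t {}A mA; rewrite -[RHS](sj_inv jth t)// preimage_setT.
Qed.

Lemma subjoining_r b th B : bijoining b -> subjoining b th -> measurable B ->
  th setT B = th setT setT * fine (nu B).
Proof.
move=> jb jth; have sth := subjoining_submeasure_r jb jth measurableT.
apply: (ergodic_submeasure (probability_setT nu) _ (flow_preserving fS) eS sth).
  exact: (measurable_flow_at fS).
by move=> t {}B mB; rewrite -[RHS](sj_inv jth t)// preimage_setT.
Qed.

(* [th - c b], with [c = th setT setT], has zero marginals by ergodicity, and
   [b - (th - c b) >= c b] since [th <= b]. *)
Lemma subjoining_perturb b th (e : R) : bijoining b -> subjoining b th ->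
  `|e| <= 1 ->
  bijoining (fun A B => b A B + e * (th A B - th setT setT * b A B)).
Proof.
move=> jb jth; rewrite ler_norml => /andP[e1 e2].
have mTA t A : measurable A -> measurable (T t @^-1` A).
  exact: (measurable_flow_preimage t fT).
have mSB t B : measurable B -> measurable (S t @^-1` B).
  exact: (measurable_flow_preimage t fS).
set c := th setT setT.
have c0 : 0 <= c by exact: (bi_ge0 jth).
have c1 : c <= 1 by rewrite -(bijoining_setTT jb); exact: (sj_le jth).
split; first split.
- move=> A B mA mB; have b0 := bi_ge0 jb mA mB; have th0 := bi_ge0 jth mA mB.
  have thb := sj_le jth mA mB; have [e0|e0] := leP 0 e.
    suff : 0 <= (1 - e * c) * b A B + e * th A B by lra.
    have : 0 <= 1 - e * c by rewrite subr_ge0 mulr_ile1.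
    by move=> ?; rewrite addr_ge0// mulr_ge0.
  suff : 0 <= (1 + e) * b A B + (- e) * (b A B - th A B) + (- e) * (c * b A B) by lra.
  by rewrite !addr_ge0// !mulr_ge0//; lra.
- by move=> A A' B mA mA' mB AA'; rewrite (bi_Ul jb)// (bi_Ul jth)//; ring.
- by move=> A B B' mA mB mB' BB'; rewrite (bi_Ur jb)// (bi_Ur jth)//; ring.
- move=> A mA; rewrite (subjoining_l jb jth)// -/c (bij_l jb)//.
  by rewrite subrr mulr0 addr0.
- move=> B mB; rewrite (subjoining_r jb jth)// -/c (bij_r jb)//.
  by rewrite subrr mulr0 addr0.
- by move=> t A B mA mB; rewrite (bij_inv jb)// (sj_inv jth).
Qed.

(** Convexity and compactness at once: [M] may be an average or an ultralimit. *)
Lemma bijoining_mean (I : Type) (M : (I -> R) -> R) (b : I -> set X -> set Y -> R) :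
  mean_functional M -> (forall i, bijoining (b i)) ->
  bijoining (fun A B => M (fun i => b i A B)).
Proof.
move=> MM jb; split.
- apply: (biadditive_mean MM) => [i|A B mA mB]; first exact: jb.
  apply: (@biadditive_bounded _ _ _ _ _ _ _ 1) => // i; first exact: jb.
  by rewrite bijoining_setTT.
- move=> A mA; rewrite -[RHS](mean_cst MM); congr M; apply/funext => i.
  by rewrite (bij_l (jb i)).
- move=> B mB; rewrite -[RHS](mean_cst MM); congr M; apply/funext => i.
  by rewrite (bij_r (jb i)).
- by move=> t A B mA mB; congr M; apply/funext => i; rewrite (bij_inv (jb i)).
Qed.

End bijoining.

Section extremal_bijoining.
Context {R : realType} dX dY (X : measurableType dX) (Y : measurableType dY).
Context (mu : probability X R) (nu : probability Y R).
Context (T : R -> X -> X) (S : R -> Y -> Y).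
Context (fT : mp_flow mu T) (fS : mp_flow nu S).
Context (eT : ergodic mu T) (eS : ergodic nu S).
Context (A : set X) (B : set Y) (mA : measurable A) (mB : measurable B).
Implicit Types b th : set X -> set Y -> R.

Let bij := bijoining mu nu T S.

(** Starting at 0 makes the value at (A, B) itself the first quantity to be maximized. Indices that
    code no rational number merely repeat 0. *)
Let q (n : nat) : R :=
  if n is n'.+1 then if unpickle n' is Some r then ratr r else 0 else 0.

Let q_dense (s dl : R) : 0 < dl -> exists n, `|s - q n| < dl.
Proof.
move=> dl0; have /rat_in_itvoo[r] : s - dl < s + dl by lra.
rewrite in_itv/= => /andP[r1 r2]; exists (pickle r).+1.
by rewrite /q pickleK ltr_distlC r1 r2.
Qed.

Let v n b := b A (S (q n) @^-1` B).

(** A decreasing chain of faces of the convex set of bijoinings; [face n.+1] is the first to settle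
    the value [v n]. *)
Fixpoint face (n : nat) b : Prop :=
  if n is n'.+1 then face n' b /\ (forall b', face n' b' -> v n' b' <= v n' b)
  else bij b.

Let face_le m n b : (m <= n)%N -> face n b -> face m b.
Proof.
elim: n => [|n ih]; first by rewrite leqn0 => /eqP ->.
by rewrite leq_eqVlt => /predU1P[->//|mn] /= [/(ih mn)].
Qed.

Let face_bij n b : face n b -> bij b.
Proof. exact: (@face_le 0). Qed.

Let mSB t : measurable (S t @^-1` B).
Proof. exact: (measurable_flow_preimage t fS). Qed.

Let v01 n b : bij b -> 0 <= v n b <= 1.
Proof.
move=> jb; rewrite (bi_ge0 jb)//= -(bijoining_setTT jb).
exact: (bi_mono jb).
Qed.

Section limit.
Context (U : set_system nat) {UU : UltraFilter U}.

(** Faces are closed. Membership is asked only [U]-almost everywhere, since in the diagonal sequence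
    of [all_faces_neq0] the term of index [k] is known to lie in [face n] only for [k >= n]. *)
Let face_ulim n (b : nat -> set X -> set Y -> R) : (forall k, bij (b k)) ->
  (\forall k \near U, face n (b k)) -> face n (fun A B => ulim U (fun k => b k A B)).
Proof.
move=> jb; elim: n => [|n ih] /= fb; first exact: (bijoining_mean (ulim_mean R UU) jb).
split; first by apply: ih; apply: filterS fb => k [].
move=> b' fb'; rewrite -[leLHS](ulim_cst (U := U)); apply: ulim_le.
- exact: bounded_family_cst.
- by apply: (@bounded_family_itv _ _ _ 0 1) => k; exact: v01.
- by apply: filterS fb => k [_]; apply.
Qed.

Context (Uoo : \oo `<=` U).

Let face_neq0 n b0 : bij b0 -> exists b, face n b.
Proof.
move=> jb0; elim: n => [|n [b1 fb1]]; first by exists b0.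
pose V := [set v n b | b in [set b | face n b]].
have supV : has_sup V.
  split; first by exists (v n b1); exists b1.
  by exists 1 => _ [b fb <-]; have /andP[] := v01 n (face_bij fb).
(* The ultralimit of a maximizing sequence attains the supremum. *)
have /choice[b Hb] (k : nat) : exists b, face n b /\ sup V - k.+1%:R^-1 < v n b.
  have k0 : 0 < k.+1%:R^-1 :> R by rewrite invr_gt0.
  by have [_ [b fb <-] ?] := sup_adherent k0 supV; exists b.
exists (fun A B => ulim U (fun k => b k A B)); split.
  apply: face_ulim => [k|]; first by have [/face_bij] := Hb k.
  by apply: filterE => k; have [] := Hb k.
move=> b' fb'; have vb' : v n b' <= sup V.
  by apply: ub_le_sup; [case: supV|exists b'].
apply: (le_trans vb'); apply/ler_addgt0Pr => e e0.
rewrite -lerBlDr -[leLHS](ulim_cst (U := U)); apply: ulim_le.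
- exact: bounded_family_cst.
- apply: (@bounded_family_itv _ _ _ 0 1) => k; apply: v01.
  by have [/face_bij] := Hb k.
apply: Uoo; exists (Num.truncn e^-1) => // k /= ek.
have [_ /ltW] := Hb k; apply: le_trans; rewrite lerD2l lerN2.
rewrite invf_ple ?posrE// (le_trans (ltW (truncnS_gt _)))// ler_nat ltnS//.
Qed.

Lemma all_faces_neq0 b0 : bij b0 -> exists b, forall n, face n b.
Proof.
move=> jb0; have /choice[b fb] n := face_neq0 n jb0.
exists (fun A B => ulim U (fun k => b k A B)) => n.
apply: face_ulim => [k|]; first exact: face_bij (fb k).
by apply: Uoo; exists n => // k /= nk; exact: face_le (fb k).
Qed.

End limit.

(** Both [b] plus and [b] minus the direction lie in the face, so maximality of [v n] at [b] forces
    [v n] to vanish on the direction. The moved bijoining is then as good a maximizer as [b], and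
    lies in the next face. *)
Let all_faces_perturb b th n : (forall k, face k b) -> subjoining T S b th ->
  v n (fun A B => th A B - th setT setT * b A B) = 0 /\ forall e : R, `|e| <= 1 ->
  face n (fun A B => b A B + e * (th A B - th setT setT * b A B)).
Proof.
move=> fb jth; have jb : bij b := fb 0%N.
have face_perturb k : (forall e : R, `|e| <= 1 ->
    face k (fun A B => b A B + e * (th A B - th setT setT * b A B))) ->
    v k (fun A B => th A B - th setT setT * b A B) = 0.
  move=> H; have [_ vb] := fb k.+1.
  have h1 := vb _ (H 1 _); have h2 := vb _ (H (-1) _).
  by rewrite /v in h1 h2 *; rewrite normrN normr1 in h2; rewrite normr1 in h1; lra.
elim: n => [|n [vn fn]].
  have H (e : R) : `|e| <= 1 ->
      face 0 (fun A B => b A B + e * (th A B - th setT setT * b A B)).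
    by move=> e1; exact: subjoining_perturb.
  by split => //; exact: face_perturb.
have H (e : R) : `|e| <= 1 ->
    face n.+1 (fun A B => b A B + e * (th A B - th setT setT * b A B)).
  move=> e1; split; first exact: fn.
  move=> b' fb'; have [_ /(_ _ fb')] := fb n.+1.
  by move: vn; rewrite /v => ->; rewrite mulr0 addr0.
by split => //; exact: face_perturb.
Qed.

(* Maximize lexicographically the values [b A (S (q n) @^-1` B)], with [q]
   enumerating the rationals from [q 0 = 0]. *)
Lemma extremal_bijoining b0 : bijoining mu nu T S b0 ->
  exists b, [/\ bijoining mu nu T S b, b0 A B <= b A B &
    forall th, subjoining T S b th -> forall s,
      th A (S s @^-1` B) = th setT setT * b A (S s @^-1` B)].
Proof.
move=> jb0; have [U [UU Uoo]] := ultraFilterLemma (eventually_filter : ProperFilter \oo).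
have [b fb] := all_faces_neq0 Uoo jb0.
have jb : bij b := fb 0%N.
exists b; split => //.
  (* [face 1] maximizes [v 0], which is the value at (A, B) because [q 0 = 0]. *)
  have [_ /(_ b0 jb0)] := fb 1%N; rewrite /v/= (_ : S 0 @^-1` B = B)//.
  by apply/seteqP; split => y /=; rewrite (flow0 fS).
move=> th jth s; apply/eqP; rewrite -subr_eq0 -normr_le0.
apply/ler_addgt0Pr => e e0; rewrite add0r.
set c := th setT setT.
have c0 : 0 <= c by exact: (bi_ge0 jth).
have c1 : c <= 1 by rewrite -(bijoining_setTT jb); exact: (sj_le jth).
have e20 : 0 < e / 2 by rewrite divr_gt0.
(* Both sides are continuous in [s], so the identity extends from the times [q n] to all times. *)
have [d1 d10 H1] := flow_submeasure_continuous fS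
  (subjoining_submeasure_r jb jth mA) mB e20.
have [d2 d20 H2] := flow_submeasure_continuous fS
  (bijoining_submeasure_r jb mA) mB e20.
have [|n] := q_dense s (_ : 0 < Num.min d1 d2); first by rewrite lt_min d10.
rewrite lt_min => /andP[/H1 {}H1 /H2 {}H2].
have [vn _] := all_faces_perturb n fb jth; rewrite /v -/c in vn.
rewrite (splitr e).
rewrite (_ : _ - _ = (th A (S s @^-1` B) - th A (S (q n) @^-1` B)) +
  c * (b A (S (q n) @^-1` B) - b A (S s @^-1` B))); last by lra.
rewrite (le_trans (ler_normD _ _))// lerD// normrM ger0_norm// distrC.
by rewrite (le_trans _ H2)// ler_piMl.
Qed.

End extremal_bijoining.

(** * Coupling the limits of the off-diagonal joinings *)

Section glue.
Context {R : realType} d1 d2 d1' d2' (Z1 : measurableType d1) (Z2 : measurableType d2)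
  (W1 : measurableType d1') (W2 : measurableType d2').
Context (f1 : Z1 -> W1) (f2 : Z2 -> W2).
Context (mf1 : measurable_fun setT f1) (mf2 : measurable_fun setT f2).
Context (lam : set W1 -> set W2 -> R) (blam : biadditive lam).
Context (m1 : set Z1 -> \bar R) (M1 : set Z1 -> R) (sM1 : submeasure m1 M1).
Context (m2 : set Z2 -> \bar R) (M2 : set Z2 -> R) (sM2 : submeasure m2 M2).
Context (C1 C2 : finType) (c1 : W1 -> C1) (c2 : W2 -> C2).

Let E1 (i : C1) : set W1 := c1 @^-1` [set i].
Let E2 (j : C2) : set W2 := c2 @^-1` [set j].

Context (mE1 : forall i, measurable (E1 i)) (mE2 : forall j, measurable (E2 j)).
Context (M1lam : forall i, M1 (f1 @^-1` E1 i) <= lam (E1 i) setT).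
Context (M2lam : forall j, M2 (f2 @^-1` E2 j) <= lam setT (E2 j)).

(** The conditional mass of [D] in the cell [i]. Where [lam] vanishes so does [M1], by [M1lam], so
    the value 0 of a division by 0 is the right one. *)
Let p1 (D : set Z1) i := M1 (D `&` f1 @^-1` E1 i) / lam (E1 i) setT.
Let p2 (D : set Z2) j := M2 (D `&` f2 @^-1` E2 j) / lam setT (E2 j).

(* The coupling of [M1] and [M2] that lies over [lam] and is conditionally
   independent given the cell of the finite partition. *)
Definition glue (D : set Z1) (D' : set Z2) : R :=
  \sum_i \sum_j lam (E1 i) (E2 j) * (p1 D i * p2 D' j).

Let mfE1 i : measurable (f1 @^-1` E1 i).
Proof. by rewrite -[X in measurable X]setTI; exact: mf1. Qed.

Let mfE2 j : measurable (f2 @^-1` E2 j).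
Proof. by rewrite -[X in measurable X]setTI; exact: mf2. Qed.

Let lam_ge0 i j : 0 <= lam (E1 i) (E2 j).
Proof. exact: (bi_ge0 blam). Qed.

Let mDE1 D i : measurable D -> measurable (D `&` f1 @^-1` E1 i).
Proof. by move=> mD; exact: measurableI. Qed.

Let mDE2 D j : measurable D -> measurable (D `&` f2 @^-1` E2 j).
Proof. by move=> mD; exact: measurableI. Qed.

Let p1_ge0 D i : measurable D -> 0 <= p1 D i.
Proof.
move=> mD; rewrite divr_ge0//; last exact: (bi_ge0 blam).
exact/(sub_ge0 sM1)/mDE1.
Qed.

Let p2_ge0 D j : measurable D -> 0 <= p2 D j.
Proof.
move=> mD; rewrite divr_ge0//; last exact: (bi_ge0 blam).
exact/(sub_ge0 sM2)/mDE2.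
Qed.

Let M1_le D i : measurable D -> M1 (D `&` f1 @^-1` E1 i) <= lam (E1 i) setT.
Proof.
move=> mD; rewrite (le_trans _ (M1lam i))//.
by apply: (sub_mono sM1 _ (mfE1 _)); [exact: mDE1|exact: subIsetr].
Qed.

Let M2_le D j : measurable D -> M2 (D `&` f2 @^-1` E2 j) <= lam setT (E2 j).
Proof.
move=> mD; rewrite (le_trans _ (M2lam j))//.
by apply: (sub_mono sM2 _ (mfE2 _)); [exact: mDE2|exact: subIsetr].
Qed.

Let p1M D i : measurable D -> lam (E1 i) setT * p1 D i = M1 (D `&` f1 @^-1` E1 i).
Proof.
move=> mD; have [l0|l0] := eqVneq (lam (E1 i) setT) 0; last by rewrite mulrC divfK.
have := M1_le i mD; rewrite l0 mul0r => M0; apply/eqP.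
by rewrite eq_le M0 (sub_ge0 sM1)//; exact: mDE1.
Qed.

Let p2M D j : measurable D -> lam setT (E2 j) * p2 D j = M2 (D `&` f2 @^-1` E2 j).
Proof.
move=> mD; have [l0|l0] := eqVneq (lam setT (E2 j)) 0; last by rewrite mulrC divfK.
have := M2_le j mD; rewrite l0 mul0r => M0; apply/eqP.
by rewrite eq_le M0 (sub_ge0 sM2)//; exact: mDE2.
Qed.

Let p1_le1 D i : measurable D -> p1 D i <= 1.
Proof.
move=> mD; have [l0|l0] := eqVneq (lam (E1 i) setT) 0; first by rewrite /p1 l0 invr0 mulr0.
have ll : 0 < lam (E1 i) setT by rewrite lt_neqAle eq_sym l0 (bi_ge0 blam).
by rewrite ler_pdivrMr// mul1r M1_le.
Qed.

Let p2_le1 D j : measurable D -> p2 D j <= 1.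
Proof.
move=> mD; have [l0|l0] := eqVneq (lam setT (E2 j)) 0; first by rewrite /p2 l0 invr0 mulr0.
have ll : 0 < lam setT (E2 j) by rewrite lt_neqAle eq_sym l0 (bi_ge0 blam).
by rewrite ler_pdivrMr// mul1r M2_le.
Qed.

Let lam_sum2 A : measurable A -> lam A setT = \sum_j lam A (E2 j).
Proof.
move=> mA; rewrite (sub_finite_sum (biadditive_right blam mA) mE2 measurableT).
by apply: eq_bigr => j _; rewrite setTI.
Qed.

Let lam_sum1 B : measurable B -> lam setT B = \sum_i lam (E1 i) B.
Proof.
move=> mB; rewrite (sub_finite_sum (biadditive_left blam mB) mE1 measurableT).
by apply: eq_bigr => i _; rewrite setTI.
Qed.

Let sum_p1 D : measurable D -> \sum_i \sum_j lam (E1 i) (E2 j) * p1 D i = M1 D.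
Proof.
move=> mD; rewrite [RHS](sub_finite_sum sM1 (c := c1 \o f1) mfE1 mD).
apply: eq_bigr => i _; rewrite -mulr_suml -lam_sum2; last exact: mE1.
by rewrite p1M.
Qed.

Let sum_p2 D : measurable D -> \sum_i \sum_j lam (E1 i) (E2 j) * p2 D j = M2 D.
Proof.
move=> mD; rewrite [RHS](sub_finite_sum sM2 (c := c2 \o f2) mfE2 mD).
rewrite exchange_big; apply: eq_bigr => j _.
rewrite -mulr_suml -lam_sum1; last exact: mE2.
by rewrite p2M.
Qed.

Lemma glue_biadditive : biadditive glue.
Proof.
split => [D D' mD mD'|D G D' mD mG mD' DG|D D' G' mD mD' mG' DG].
- by do 2!apply: sumr_ge0 => ? _; rewrite mulr_ge0// mulr_ge0// ?p1_ge0// p2_ge0.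
- rewrite /glue -big_split; apply: eq_bigr => i _ /=.
  rewrite -big_split; apply: eq_bigr => j _ /=.
  rewrite -mulrDr -mulrDl; congr (_ * (_ * _)); rewrite /p1 -mulrDl setIUl.
  by rewrite (subU sM1)//; [exact: mDE1|exact: mDE1|rewrite setIACA DG set0I].
- rewrite /glue -big_split; apply: eq_bigr => i _ /=.
  rewrite -big_split; apply: eq_bigr => j _ /=.
  rewrite -mulrDr -mulrDr; congr (_ * (_ * _)); rewrite /p2 -mulrDl setIUl.
  by rewrite (subU sM2)//; [exact: mDE2|exact: mDE2|rewrite setIACA DG set0I].
Qed.

Lemma glue_le1 D D' : measurable D -> measurable D' -> glue D D' <= M1 D.
Proof.
move=> mD mD'; rewrite -(sum_p1 mD); do 2!apply: ler_sum => ? _.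
by rewrite ler_wpM2l// ler_piMr// ?p1_ge0// p2_le1.
Qed.

Lemma glue_le2 D D' : measurable D -> measurable D' -> glue D D' <= M2 D'.
Proof.
move=> mD mD'; rewrite -(sum_p2 mD'); do 2!apply: ler_sum => ? _.
by rewrite ler_wpM2l// ler_piMl// ?p2_ge0// p1_le1.
Qed.

(** Cell by cell, the product of [1 - p1 D i] and [1 - p2 D' j] is nonnegative; sum this with the
    weights [lam (E1 i) (E2 j)]. *)
Lemma glue_ge D D' : measurable D -> measurable D' ->
  M1 D + M2 D' - lam setT setT <= glue D D'.
Proof.
move=> mD mD'; rewrite -(sum_p1 mD) -(sum_p2 mD') lam_sum1//.
under [X in _ - X]eq_bigr => i _ do rewrite (lam_sum2 (mE1 i)).
rewrite -sumrN -!big_split/=; apply: ler_sum => i _.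
rewrite -sumrN -!big_split/=; apply: ler_sum => j _.
have l0 := lam_ge0 i j; have p10 := p1_le1 i mD; have p20 := p2_le1 j mD'.
suff : 0 <= lam (E1 i) (E2 j) * ((1 - p1 D i) * (1 - p2 D' j)) by lra.
by rewrite mulr_ge0// mulr_ge0// subr_ge0.
Qed.

(** On unions of cells each term is either 0 or at most [lam (E1 i) (E2 j)], because conditional
    masses are at most 1. *)
Lemma glue_over (s1 : pred C1) (s2 : pred C2) :
  glue (f1 @^-1` (c1 @^-1` [set i | s1 i])) (f2 @^-1` (c2 @^-1` [set j | s2 j])) <=
  lam (c1 @^-1` [set i | s1 i]) (c2 @^-1` [set j | s2 j]).
Proof.
set A := c1 @^-1` _; set B := c2 @^-1` _.
have AE i : A `&` E1 i = if s1 i then E1 i else set0.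
  by apply/seteqP; rewrite /A/E1; case: ifPn => si; split => w //=;
    [by case|move=> ->|by case=> /= sw wi; move: si; rewrite -wi sw].
have BE j : B `&` E2 j = if s2 j then E2 j else set0.
  by apply/seteqP; rewrite /B/E2; case: ifPn => si; split => w //=;
    [by case|move=> ->|by case=> /= sw wi; move: si; rewrite -wi sw].
have mA : measurable A.
  have -> : A = \bigcup_(i in [set i | s1 i]) E1 i.
    by apply/seteqP; split => w; [exists (c1 w)|by case=> i /= si wi; rewrite /A /= wi].
  by apply: fin_bigcup_measurable => //; exact: finite_finset.
have mB : measurable B.
  have -> : B = \bigcup_(j in [set j | s2 j]) E2 j.
    by apply/seteqP; split => w; [exists (c2 w)|by case=> j /= sj wj; rewrite /B /= wj].
  by apply: fin_bigcup_measurable => //; exact: finite_finset.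
have mfA : measurable (f1 @^-1` A) by rewrite -[X in measurable X]setTI; exact: mf1.
have mfB : measurable (f2 @^-1` B) by rewrite -[X in measurable X]setTI; exact: mf2.
rewrite [leRHS](sub_finite_sum (biadditive_left blam mB) mE1 mA).
apply: ler_sum => i _; have mAE : measurable (A `&` E1 i) by exact: measurableI.
rewrite [leRHS](sub_finite_sum (biadditive_right blam mAE) mE2 mB).
apply: ler_sum => j _; have mBE : measurable (B `&` E2 j) by exact: measurableI.
have [si|nsi] := boolP (s1 i); last first.
  rewrite {1}/p1 -preimage_setI AE (negbTE nsi) preimage_set0 (sub_set0 sM1).
  by rewrite !mul0r mulr0 (bi_ge0 blam).
have [sj|nsj] := boolP (s2 j); last first.
  rewrite {1}/p2 -preimage_setI (BE j) (negbTE nsj) preimage_set0 (sub_set0 sM2).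
  by rewrite mul0r !mulr0 (bi_ge0 blam).
rewrite AE BE si sj ler_piMr// mulr_ile1 ?p1_ge0 ?p2_ge0 ?p1_le1 ?p2_le1//.
Qed.

End glue.

(** * Finite partitions into boxes *)

Section coloring.
Context d (X : measurableType d).
Implicit Types l : seq (set X).

(* Non-measurable members of [l] are ignored. *)
Definition coloring l (x : X) : {ffun 'I_(size l) -> bool} :=
  [ffun i : 'I_(size l) => `[< measurable (nth set0 l i) /\ nth set0 l i x >]].

Lemma measurable_coloring l f : measurable (coloring l @^-1` [set f]).
Proof.
have -> : coloring l @^-1` [set f] =
    \bigcap_(i in [set: 'I_(size l)]) [set x | coloring l x i = f i].
  apply/seteqP; split => [x <- i //|x H]; apply/ffunP => i; exact: H.
apply: fin_bigcap_measurable => [|i _]; first exact: finite_finset.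
have [mA|nA] := pselect (measurable (nth set0 l i)).
  rewrite (_ : mkset _ = if f i then nth set0 l i else ~` nth set0 l i).
    by case: ifP => _ //; exact: measurableC.
  apply/seteqP; case: ifPn => fi; split => x /=; rewrite ffunE ?fi ?(negbTE fi).
  - by move/asboolP => [].
  - by move=> Ax; apply/asboolP.
  - by move/asboolPn => H Ax; apply: H.
  - by move=> Ax; apply/asboolPn => -[].
rewrite (_ : mkset _ = if f i then set0 else setT); first by case: ifP.
apply/seteqP; case: ifPn => fi; split => x //=; rewrite ffunE ?fi ?(negbTE fi).
- by move/asboolP => [].
- by move=> _; apply/asboolPn => -[].
Qed.

Lemma coloring_preimage l A : measurable A -> A \in l ->
  exists s : pred {ffun 'I_(size l) -> bool}, A = coloring l @^-1` [set f | s f].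
Proof.
move=> mA Al; have il : (index A l < size l)%N by rewrite index_mem.
exists (fun f => f (Ordinal il)); apply/seteqP; split => x /=; rewrite ffunE/= nth_index//.
  by move=> Ax; apply/asboolP.
by move/asboolP => [].
Qed.

Definition coloring3 l (w : X * X * X) :=
  (coloring l w.1.1, coloring l w.1.2, coloring l w.2).

Lemma coloring3_preimage l f : coloring3 l @^-1` [set f] =
  (coloring l @^-1` [set f.1.1]) `*` (coloring l @^-1` [set f.1.2]) `*`
  (coloring l @^-1` [set f.2]).
Proof.
by case: f => -[f g] h; apply/seteqP; split => -[[x y] z] /=; [case=> <- <- <-|by case=> -[/= <- <-] <-].
Qed.

Lemma measurable_coloring3 l f : measurable (coloring3 l @^-1` [set f]).
Proof.
rewrite coloring3_preimage; apply: measurableX; last exact: measurable_coloring.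
by apply: measurableX; exact: measurable_coloring.
Qed.

End coloring.

(** * Triples on an orbit and the lift of the integral mixture *)

Section triple.
Context {R : realType} d (X : measurableType d) (mu : probability X R).
Context (T : R -> X -> X) (fT : mp_flow mu T).

Definition triple (t s : R) (x : X) : X * X * X := (T t x, T s x, x).

Lemma measurable_triple t s : measurable_fun [set: X] (triple t s).
Proof.
have mT u := measurable_flow_at fT u.
by do !apply: measurable_fun_pair => //.
Qed.

(* [z] is [((t, u), x)]; the point [(T_(-t) x, T_(-u) x, x)] has the coordinates
   [place h z] for [h = fst], [h = snd] and [h = 0]. *)
Definition spread (z : (R * R) * X) : X * X * X := triple (- z.1.1) (- z.1.2) z.2.

Definition place (h : R * R -> R) (z : (R * R) * X) : X := T (- h z.1) z.2.

Lemma measurable_place h : measurable_fun setT h -> measurable_fun setT (place h).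
Proof.
move=> mh; apply: (measurableT_comp (measurable_flow fT) (g := fun z => (- h z.1, z.2))).
apply: measurable_fun_pair; last exact: measurable_snd.
by apply: measurable_funN; exact: (measurableT_comp mh measurable_fst).
Qed.

Lemma place_preimage h s A :
  prod_flow (fun (_ : R) (p : R * R) => p) T s @^-1` (place h @^-1` A) =
  place h @^-1` (T s @^-1` A).
Proof.
by apply/seteqP; split => z; rewrite /place/= -!(flowD fT) addrC.
Qed.

Lemma measurable_spread : measurable_fun [set: (R * R) * X] spread.
Proof.
apply: measurable_fun_pair; last exact: measurable_snd.
by apply: measurable_fun_pair; apply: measurable_place;
  [exact: measurable_fst|exact: measurable_snd].
Qed.

(** The mixture is the image of a product measure; this supplies the space on which the parameter in
    the plane can be observed. *)
Lemma offdiag_mix_spread (P : probability (R * R)%type R) (E : set (X * X * X)) :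
  offdiag_mix mu T P E = (P \x mu)%E (spread @^-1` E).
Proof.
apply: eq_integral => p _; rewrite /offdiag /pushforward /= xsectionE.
by congr (mu _).
Qed.

(** Dropping the part of weight [alpha], which is nonnegative on a box, leaves the lower bound. *)
Lemma limit_marginal_ge (a b : nat -> R) (alpha : R) (P : probability (R * R)%type R)
    (xi : probability (X * X * X)%type R) (U : set_system nat) (A1 A2 A3 : set X) :
  UltraFilter U -> \oo `<=` U -> 0 <= alpha < 1 ->
  joining3_cvg (fun n => offdiag mu T (a n) (b n))
    (fun A => (1 - alpha)%:E * offdiag_mix mu T P A + alpha%:E * xi A)%E ->
  measurable A1 -> measurable A2 -> measurable A3 ->
  (1 - alpha) * fine ((P \x mu)%E (spread @^-1` (A1 `*` A2 `*` A3))) <=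
  ulim U (fun n => fine (mu (triple (a n) (b n) @^-1` (A1 `*` A2 `*` A3)))).
Proof.
move=> UU Uoo /andP[al0 al1] cvgT m1 m2 m3; have := cvgT _ _ _ m1 m2 m3.
set E := A1 `*` A2 `*` A3; have mE : measurable E by do !apply: measurableX.
rewrite offdiag_mix_spread; set w := (P \x mu)%E _.
have wfin : w \is a fin_num.
  have mS : measurable (spread @^-1` E).
    by rewrite -[X in measurable X]setTI; exact: measurable_spread.
  have w1 : (w <= 1)%E.
    by rewrite -(product_probability_setT P mu); apply: le_measure; rewrite ?inE.
  by rewrite ge0_fin_numE ?(le_lt_trans w1) ?ltry//; exact: measure_ge0.
have xfin : xi E \is a fin_num by exact: fin_num_measure.
rewrite -(fineK wfin) -(fineK xfin) -!EFinM -EFinD => /fine_cvgP[_ cE].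
rewrite (ulim_eq (l := (1 - alpha) * fine w + alpha * fine (xi E))).
  by rewrite lerDl mulr_ge0// fine_ge0.
by apply: cvg_trans cE => V; exact: Uoo.
Qed.

End triple.

Lemma submeasureZ (R : realType) d (Z : measurableType d) (m : set Z -> \bar R)
    (k : set Z -> R) (c : R) : 0 <= c <= 1 -> submeasure m k ->
  submeasure m (fun A => c * k A).
Proof.
move=> /andP[c0 c1] sk; split => [A mA|A B mA mB AB|A mA].
- by rewrite mulr_ge0// (sub_ge0 sk).
- by rewrite (subU sk)// mulrDr.
- rewrite (le_trans _ (sub_le sk mA))// lee_fin ler_piMl//.
  exact: (sub_ge0 sk).
Qed.

Lemma product_fine_submeasure (R : realType) d1 d2 (X : measurableType d1)
    (Y : measurableType d2) (mu : probability X R) (nu : probability Y R) :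
  submeasure (mu \x nu)%E (fun D => fine ((mu \x nu)%E D)).
Proof.
pose m : {measure set (X * Y) -> \bar R} := (mu \x nu)%E.
have [|m' mE] := measure_finite_pack (m := m).
  by rewrite /m [ltLHS]product_probability_setT ltry.
by have := fine_submeasure m'; rewrite mE.
Qed.

Lemma biadditive_preimage (R : realType) d1 d2 d1' d2' (Z1 : measurableType d1)
    (Z2 : measurableType d2) (W1 : measurableType d1') (W2 : measurableType d2')
    (f : Z1 -> W1) (g : Z2 -> W2) (b : set Z1 -> set Z2 -> R) :
  measurable_fun setT f -> measurable_fun setT g -> biadditive b ->
  biadditive (fun A B => b (f @^-1` A) (g @^-1` B)).
Proof.
move=> mf mg bb.
have mfA A : measurable A -> measurable (f @^-1` A).
  by move=> mA; rewrite -[X in measurable X]setTI; exact: mf.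
have mgB B : measurable B -> measurable (g @^-1` B).
  by move=> mB; rewrite -[X in measurable X]setTI; exact: mg.
split => [A B mA mB|A A' B mA mA' mB AA'|A B B' mA mB mB' BB'].
- by apply: (bi_ge0 bb); [exact: mfA|exact: mgB].
- rewrite preimage_setU (bi_Ul bb)//; [exact: mfA|exact: mfA|exact: mgB|].
  by rewrite -preimage_setI AA' preimage_set0.
- rewrite preimage_setU (bi_Ur bb)//; [exact: mfA|exact: mgB|exact: mgB|].
  by rewrite -preimage_setI BB' preimage_set0.
Qed.

Lemma constant_mp_flow (R : realType) d (X : measurableType d) (mu : set X -> \bar R) :
  mp_flow mu (fun (_ : R) x => x).
Proof. by split => //; exact: measurable_snd. Qed.

Section coupling.
Context {R : realType} dX dY (X : measurableType dX) (Y : measurableType dY).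
Context (mu : probability X R) (nu : probability Y R).
Context (T : R -> X -> X) (S : R -> Y -> Y).
Context (fT : mp_flow mu T) (fS : mp_flow nu S).
Context (r : set X -> set Y -> R) (jr : bijoining mu nu T S r).
Context (a b : nat -> R) (alpha alpha' : R).
Context (P Q : probability (R * R)%type R).
Context (xi1 : probability (X * X * X)%type R) (xi2 : probability (Y * Y * Y)%type R).
Context (al01 : 0 <= alpha < 1) (al'01 : 0 <= alpha' < 1).
Context (cvgT : joining3_cvg (fun n => offdiag mu T (a n) (b n))
  (fun A => (1 - alpha)%:E * offdiag_mix mu T P A + alpha%:E * xi1 A)%E).
Context (cvgS : joining3_cvg (fun n => offdiag nu S (a n) (b n))
  (fun A => (1 - alpha')%:E * offdiag_mix nu S Q A + alpha'%:E * xi2 A)%E).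

Let M1 (D : set ((R * R) * X)) := (1 - alpha) * fine ((P \x mu)%E D).
Let M2 (D : set ((R * R) * Y)) := (1 - alpha') * fine ((Q \x nu)%E D).
Let tau := prod_flow (fun (_ : R) (p : R * R) => p) T.
Let sig := prod_flow (fun (_ : R) (p : R * R) => p) S.

Let sM1 : submeasure (P \x mu)%E M1.
Proof.
apply: submeasureZ; last exact: product_fine_submeasure.
by case/andP: al01 => ? ?; apply/andP; split; lra.
Qed.

Let sM2 : submeasure (Q \x nu)%E M2.
Proof.
apply: submeasureZ; last exact: product_fine_submeasure.
by case/andP: al'01 => ? ?; apply/andP; split; lra.
Qed.

Let mtau s D : measurable D -> measurable (tau s @^-1` D).
Proof. exact: (measurable_prod_flow_preimage (constant_mp_flow P) fT). Qed.

Let msig s D : measurable D -> measurable (sig s @^-1` D).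
Proof. exact: (measurable_prod_flow_preimage (constant_mp_flow Q) fS). Qed.

Let M1_tau s D : measurable D -> M1 (tau s @^-1` D) = M1 D.
Proof.
by move=> mD; rewrite /M1 (prod_flow_invariant (constant_mp_flow P) fT s mD).
Qed.

Let M2_sig s D : measurable D -> M2 (sig s @^-1` D) = M2 D.
Proof.
by move=> mD; rewrite /M2 (prod_flow_invariant (constant_mp_flow Q) fS s mD).
Qed.

Section static.
Context (U : set_system nat) {UU : UltraFilter U} (Uoo : \oo `<=` U).

(** The off-diagonal self-joining of the product flow under [r] at the times [a n] and [b n], with
    its three coordinates in [X] grouped apart from the three in [Y]. *)
Let lamn n (E : set (X * X * X)) (F : set (Y * Y * Y)) :=
  r (triple T (a n) (b n) @^-1` E) (triple S (a n) (b n) @^-1` F).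

Let lam E F := ulim U (fun n => lamn n E F).

Let lamn_biadditive n : biadditive (lamn n).
Proof.
by apply: biadditive_preimage (bij_add jr);
  [exact: (measurable_triple fT)|exact: (measurable_triple fS)].
Qed.

Let lam_biadditive : biadditive lam.
Proof.
apply: (biadditive_mean (ulim_mean R UU)) => // A B mA mB.
apply: (@biadditive_bounded _ _ _ _ _ _ _ 1) => // n.
by rewrite /lamn !preimage_setT (bijoining_setTT jr).
Qed.

Let lam_setTT : lam setT setT = 1.
Proof.
rewrite -(ulim_cst (U := U) 1); congr ulim; apply/funext => n.
by rewrite /lamn !preimage_setT (bijoining_setTT jr).
Qed.

Let lamE (f : X * X * X -> X) (g : Y * Y * Y -> Y) A B :
  (forall n, r (triple T (a n) (b n) @^-1` (f @^-1` A))
               (triple S (a n) (b n) @^-1` (g @^-1` B)) = r A B) ->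
  lam (f @^-1` A) (g @^-1` B) = r A B.
Proof.
by move=> H; rewrite -[RHS](ulim_cst (U := U)); congr ulim; apply/funext => n; exact: H.
Qed.

Let cell_le1 l i : M1 (spread T @^-1` (coloring3 l @^-1` [set i])) <=
  lam (coloring3 l @^-1` [set i]) setT.
Proof.
have mc := @measurable_coloring _ X l.
rewrite coloring3_preimage (le_trans (limit_marginal_ge fT UU Uoo al01 cvgT (mc _) (mc _) (mc _)))//.
rewrite le_eqVlt; apply/orP; left; apply/eqP; congr ulim; apply/funext => n.
rewrite /lamn preimage_setT (bij_l jr)// -[X in measurable X]setTI.
apply: (measurable_triple fT) => //; apply: measurableX => //.
exact: measurableX.
Qed.

Let cell_le2 l i : M2 (spread S @^-1` (coloring3 l @^-1` [set i])) <=
  lam setT (coloring3 l @^-1` [set i]).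
Proof.
have mc := @measurable_coloring _ Y l.
rewrite coloring3_preimage (le_trans (limit_marginal_ge fS UU Uoo al'01 cvgS (mc _) (mc _) (mc _)))//.
rewrite le_eqVlt; apply/orP; left; apply/eqP; congr ulim; apply/funext => n.
rewrite /lamn preimage_setT (bij_r jr)// -[X in measurable X]setTI.
apply: (measurable_triple fS) => //; apply: measurableX => //.
exact: measurableX.
Qed.

Let G (ll : seq (set X) * seq (set Y)) :=
  glue (spread T) (spread S) lam M1 M2 (coloring3 ll.1) (coloring3 ll.2).

Let mT := measurable_spread fT.
Let mS := measurable_spread fS.

Let G_biadditive ll : biadditive (G ll).
Proof.
by apply: glue_biadditive; [exact: mT|exact: mS|exact: lam_biadditive|
  exact: sM1|exact: sM2|exact: measurable_coloring3|exact: measurable_coloring3].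
Qed.

Let G_over ll (f : X * X * X -> X) (g : Y * Y * Y -> Y)
    (s1 : pred _) (s2 : pred _) A B :
  f @^-1` A = coloring3 ll.1 @^-1` [set i | s1 i] ->
  g @^-1` B = coloring3 ll.2 @^-1` [set j | s2 j] ->
  G ll (spread T @^-1` (f @^-1` A)) (spread S @^-1` (g @^-1` B)) <=
  lam (f @^-1` A) (g @^-1` B).
Proof.
move=> -> ->.
exact: (glue_over mT mS lam_biadditive sM1 sM2 (@measurable_coloring3 _ X ll.1)
  (@measurable_coloring3 _ Y ll.2) (@cell_le1 ll.1) (@cell_le2 ll.2) s1 s2).
Qed.

(* The first marginal of [lam] is known on boxes only; this is why [L] is an
   ultralimit of gluings over finite partitions into boxes. *)
Lemma static_coupling_exists : exists L : set ((R * R) * X) -> set ((R * R) * Y) -> R,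
  [/\ biadditive L,
      forall D D', measurable D -> measurable D' -> L D D' <= M1 D,
      forall D D', measurable D -> measurable D' -> L D D' <= M2 D',
      forall D D', measurable D -> measurable D' -> M1 D + M2 D' - 1 <= L D D' &
      forall h, [\/ h = fst, h = snd | h = fun=> 0] ->
        forall A B, measurable A -> measurable B ->
        L (place T h @^-1` A) (place S h @^-1` B) <= r A B].
Proof.
(* Lists are directed by inclusion, so along [V] any given measurable set is eventually listed and
   is then a union of colour classes. *)
pose base (ll : seq (set X) * seq (set Y)) : set (seq (set X) * seq (set Y)) :=
  [set kk : seq (set X) * seq (set Y) | {subset ll.1 <= kk.1} /\ {subset ll.2 <= kk.2}].
have PF : ProperFilter (filter_from setT base).
  apply: filter_from_proper => [|ll _]; last by exists ll; split.
  apply: filter_from_filter; first by exists ([::], [::]).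
  move=> [l1 l2] [k1 k2] _ _; exists (l1 ++ k1, l2 ++ k2) => // -[h1 h2] [/= s1 s2].
  by split; split => A Al /=; [apply: s1|apply: s2|apply: s1|apply: s2];
    rewrite mem_cat Al ?orbT.
have [V [VV subV]] := ultraFilterLemma PF.
have Gle1 ll D D' : measurable D -> measurable D' -> G ll D D' <= M1 D.
  exact: (glue_le1 mT mS lam_biadditive sM1 sM2 (@measurable_coloring3 _ X ll.1)
    (@measurable_coloring3 _ Y ll.2) (@cell_le1 ll.1) (@cell_le2 ll.2)).
have Gle2 ll D D' : measurable D -> measurable D' -> G ll D D' <= M2 D'.
  exact: (glue_le2 mT mS lam_biadditive sM1 sM2 (@measurable_coloring3 _ X ll.1)
    (@measurable_coloring3 _ Y ll.2) (@cell_le1 ll.1) (@cell_le2 ll.2)).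
have Gge ll D D' : measurable D -> measurable D' -> M1 D + M2 D' - 1 <= G ll D D'.
  rewrite -lam_setTT.
  exact: (glue_ge mT mS lam_biadditive sM1 sM2 (@measurable_coloring3 _ X ll.1)
    (@measurable_coloring3 _ Y ll.2) (@cell_le1 ll.1) (@cell_le2 ll.2)).
have bG D D' : measurable D -> measurable D' -> bounded_family (fun ll => G ll D D').
  by move=> mD mD'; apply: (biadditive_bounded (c := M1 setT)) => // ll; exact: Gle1.
have VM := ulim_mean R VV.
exists (fun D D' => ulim V (fun ll => G ll D D')); split.
- exact: (biadditive_mean VM).
- move=> D D' mD mD'; rewrite -[leRHS](mean_cst VM); apply: (mean_le VM).
  + exact: bG.
  + exact: bounded_family_cst.
  + by move=> ll; exact: Gle1.
- move=> D D' mD mD'; rewrite -[leRHS](mean_cst VM); apply: (mean_le VM).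
  + exact: bG.
  + exact: bounded_family_cst.
  + by move=> ll; exact: Gle2.
- move=> D D' mD mD'; rewrite -[leLHS](mean_cst VM); apply: (mean_le VM).
  + exact: bounded_family_cst.
  + exact: bG.
  + by move=> ll; exact: Gge.
have over (f : X * X * X -> X) (g : Y * Y * Y -> Y) A B :
    measurable A -> measurable B -> measurable_fun setT f -> measurable_fun setT g ->
    (forall ll, A \in ll.1 -> B \in ll.2 -> exists (s1 : pred _) (s2 : pred _),
      f @^-1` A = coloring3 ll.1 @^-1` [set i | s1 i] /\
      g @^-1` B = coloring3 ll.2 @^-1` [set j | s2 j]) ->
    (forall n, r (triple T (a n) (b n) @^-1` (f @^-1` A))
                 (triple S (a n) (b n) @^-1` (g @^-1` B)) = r A B) ->
    ulim V (fun ll => G ll (spread T @^-1` (f @^-1` A))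
                           (spread S @^-1` (g @^-1` B))) <= r A B.
  move=> mA mB mf mg Hs HAB; rewrite -(lamE HAB) -[leRHS](ulim_cst (U := V)).
  apply: ulim_le.
  - apply: bG; rewrite -[X in measurable X]setTI; [apply: mT|apply: mS] => //.
      by rewrite -[X in measurable X]setTI; exact: mf.
    by rewrite -[X in measurable X]setTI; exact: mg.
  - exact: bounded_family_cst.
  - apply: subV; exists ([:: A], [:: B]) => // ll [/= Al Bl].
    have [s1 [s2 [e1 e2]]] := Hs ll (Al _ (mem_head _ _)) (Bl _ (mem_head _ _)).
    exact: G_over e1 e2.
move=> h Hh A B mA mB.
have cA (ll : seq (set X) * seq (set Y)) := coloring_preimage (l := ll.1) mA.
have cB (ll : seq (set X) * seq (set Y)) := coloring_preimage (l := ll.2) mB.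
case: Hh => ->.
- apply: (over (fun w => w.1.1) (fun w => w.1.1)) => //.
  + exact: (measurableT_comp measurable_fst measurable_fst).
  + exact: (measurableT_comp measurable_fst measurable_fst).
  + move=> ll /(cA ll)[s1 e1] /(cB ll)[s2 e2].
    exists (fun i => s1 i.1.1), (fun i => s2 i.1.1).
    by rewrite {1}e1 {1}e2.
  + by move=> n; exact: (bij_inv jr).
- apply: (over (fun w => w.1.2) (fun w => w.1.2)) => //.
  + exact: (measurableT_comp measurable_snd measurable_fst).
  + exact: (measurableT_comp measurable_snd measurable_fst).
  + move=> ll /(cA ll)[s1 e1] /(cB ll)[s2 e2].
    exists (fun i => s1 i.1.2), (fun i => s2 i.1.2).
    by rewrite {1}e1 {1}e2.
  + by move=> n; exact: (bij_inv jr).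
- have place0 d (Z : measurableType d) (F : R -> Z -> Z) : (forall z, F 0 z = z) ->
      place F (fun=> 0) = @snd (R * R) Z.
    by move=> F0; apply/funext => z; rewrite /place oppr0 F0.
  rewrite (place0 _ _ _ (flow0 fT)) (place0 _ _ _ (flow0 fS)).
  apply: (over (fun w => w.2) (fun w => w.2)) => //;
    [exact: measurable_snd|exact: measurable_snd|].
  move=> ll /(cA ll)[s1 e1] /(cB ll)[s2 e2].
  exists (fun i => s1 i.2), (fun i => s2 i.2).
  by rewrite {1}e1 {1}e2.
Qed.

End static.

(** The static coupling is averaged over the flow that moves the fibres and fixes the plane. The
    bounds survive because [P \x mu], [Q \x nu] and [r] are invariant. *)
Lemma coupling_exists : exists L : set ((R * R) * X) -> set ((R * R) * Y) -> R,
  [/\ biadditive L,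
      forall D D', measurable D -> measurable D' ->
        L D D' <= (1 - alpha) * fine ((P \x mu)%E D) /\
        L D D' <= (1 - alpha') * fine ((Q \x nu)%E D'),
      forall D D', measurable D -> measurable D' ->
        (1 - alpha) * fine ((P \x mu)%E D) +
        (1 - alpha') * fine ((Q \x nu)%E D') - 1 <= L D D',
      forall s D D', measurable D -> measurable D' ->
        L (prod_flow (fun _ p => p) T s @^-1` D)
          (prod_flow (fun _ p => p) S s @^-1` D') = L D D' &
      forall h, [\/ h = fst, h = snd | h = fun=> 0] ->
        forall A B, measurable A -> measurable B ->
        L (place T h @^-1` A) (place S h @^-1` B) <= r A B].
Proof.
have [U [UU Uoo]] := ultraFilterLemma (eventually_filter : ProperFilter \oo).
have [L0 [L0b L01 L02 L0ge L0over]] := static_coupling_exists Uoo.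
have [M MM] := @invariant_mean_exists R.
pose Ls s D D' := L0 (tau s @^-1` D) (sig s @^-1` D').
have bLs s : biadditive (Ls s).
  apply: biadditive_preimage L0b.
    exact: (measurable_prod_flow (constant_mp_flow P) fT).
  exact: (measurable_prod_flow (constant_mp_flow Q) fS).
have bnd D D' : measurable D -> measurable D' -> bounded_family (fun s => Ls s D D').
  move=> mD mD'; apply: (biadditive_bounded (c := M1 setT)) => // s.
  by rewrite /Ls !preimage_setT L01.
exists (fun D D' => M (fun s => Ls s D D')); split.
- exact: (biadditive_mean MM).
- move=> D D' mD mD'; split.
    rewrite -[leRHS](mean_cst MM); apply: (mean_le MM) => [||s].
    + exact: bnd.
    + exact: bounded_family_cst.
    + by rewrite -/(M1 D) -(M1_tau s mD) L01//; [exact: mtau|exact: msig].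
  rewrite -[leRHS](mean_cst MM); apply: (mean_le MM) => [||s].
  + exact: bnd.
  + exact: bounded_family_cst.
  + by rewrite -/(M2 D') -(M2_sig s mD') L02//; [exact: mtau|exact: msig].
- move=> D D' mD mD'; rewrite -[leLHS](mean_cst MM); apply: (mean_le MM) => [||s].
  + exact: bounded_family_cst.
  + exact: bnd.
  + rewrite -/(M1 D) -/(M2 D') -(M1_tau s mD) -(M2_sig s mD').
    by apply: L0ge; [exact: mtau|exact: msig].
- move=> s D D' mD mD'; rewrite -[RHS](mean_shift MM s); last exact: bnd.
  congr M; apply/funext => t; rewrite /Ls.
  by rewrite (prod_flow_preimageD (constant_mp_flow P) fT)
    (prod_flow_preimageD (constant_mp_flow Q) fS).
- move=> h Hh A B mA mB; rewrite -[leRHS](mean_cst MM).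
  have mh : measurable_fun [set: R * R] h.
    case: Hh => ->; [exact: measurable_fst|exact: measurable_snd|].
    exact: measurable_cst.
  have mA' : measurable (place T h @^-1` A).
    by rewrite -[X in measurable X]setTI; exact: (measurable_place fT mh).
  have mB' : measurable (place S h @^-1` B).
    by rewrite -[X in measurable X]setTI; exact: (measurable_place fS mh).
  apply: (mean_le MM) => [||s]; [exact: bnd|exact: bounded_family_cst|].
  rewrite /Ls -(bij_inv jr s mA mB) (place_preimage fT) (place_preimage fS).
  by apply: L0over => //; [exact: (measurable_flow_preimage s fT)|
    exact: (measurable_flow_preimage s fS)].
Qed.

End coupling.

(** * Periodicity of extremal bijoinings *)

(** Compactness is applied to the filter of those [W] for which [K] minus [W] is negligible: a
    cluster point of it has no neighbourhood with negligible trace on [K]. *)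
Lemma compact_ideal_point (T : topologicalType) (K : set T) (I : set T -> Prop) :
  compact K -> I set0 -> (forall A B, A `<=` B -> I B -> I A) ->
  (forall A B, I A -> I B -> I (A `|` B)) -> ~ I K ->
  exists2 p, K p & forall U, nbhs p U -> ~ I (U `&` K).
Proof.
move=> cK I0 IS IU nIK; pose G : set_system T := [set W | I (K `\` W)].
have FG : Filter G.
  split; rewrite /G/=; first by rewrite setDT.
  move=> W W' IW IW'; apply: IS (IU _ _ IW IW').
    by move=> x [Kx /not_andP[?|?]]; [left|right].
  by move=> W W' WW'; apply: IS; exact: setDS.
have PG : ProperFilter G.
  by apply: Build_ProperFilter; rewrite /G/= setD0.
have [p [Kp clp]] : K `&` cluster G !=set0 by apply: cK; rewrite /G/= setDv.
exists p => // U Up IUK.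
have [x [nUx Ux]] : (~` U) `&` U !=set0.
  by apply: clp => //; rewrite /G/= setDE setCK setIC.
by [].
Qed.

(** [c] is additive in each variable, not a measure on pairs, so the points are found one after the
    other: [p] against [K'], then [q] against all neighbourhoods of [p]. Neighbourhoods need not be
    measurable, hence the measurable hulls in [I1] and [I2]. *)
Lemma support_point (R : realType) (c : set (R * R) -> set (R * R) -> R)
    (K K' : set (R * R)) : biadditive c -> compact K -> compact K' ->
  measurable K -> measurable K' -> 0 < c K K' ->
  exists p q, [/\ K p, K' q & forall U V, nbhs p U -> measurable U ->
    nbhs q V -> measurable V -> 0 < c U V].
Proof.
move=> bc cK cK' mK mK' cKK'.
have c0l A : measurable A -> c set0 A = 0.
  by move=> mA; exact: (sub_set0 (biadditive_left bc mA)).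
have c0r A : measurable A -> c A set0 = 0.
  by move=> mA; exact: (sub_set0 (biadditive_right bc mA)).
pose I1 (W : set (R * R)) := exists W', [/\ measurable W', W `<=` W' & c W' K' = 0].
have [p Kp Hp] : exists2 p, K p & forall U, nbhs p U -> ~ I1 (U `&` K).
  apply: compact_ideal_point => //.
  - by exists set0; split => //; exact: c0l.
  - by move=> A B AB [W [mW BW W0]]; exists W; split => //; exact: subset_trans BW.
  - move=> A B [V [mV AV V0]] [W [mW BW W0]]; exists (V `|` W).
    split; [exact: measurableU|exact: setUSS|].
    apply/eqP; rewrite eq_le (bi_ge0 bc) ?andbT//; last exact: measurableU.
    rewrite (le_trans (sub_subadd (biadditive_left bc mK') mV mW))//.
    by rewrite V0 W0 addr0.
  - move=> [W [mW KW W0]]; move: cKK'; apply/negP; rewrite -leNgt -W0.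
    exact: (bi_mono bc).
pose I2 (W : set (R * R)) := exists U, [/\ nbhs p U, measurable U &
  exists W', [/\ measurable W', W `<=` W' & c U W' = 0]].
have [q Kq Hq] : exists2 q, K' q & forall V, nbhs q V -> ~ I2 (V `&` K').
  apply: compact_ideal_point => //.
  - exists setT; split => //; first exact: filterT.
    by exists set0; split => //; exact: c0r.
  - move=> A B AB [U [pU mU [W [mW BW W0]]]]; exists U; split => //.
    by exists W; split => //; exact: subset_trans BW.
  - move=> A B [U [pU mU [V [mV AV V0]]]] [U' [pU' mU' [W [mW BW W0]]]].
    exists (U `&` U'); split; [exact: filterI|exact: measurableI|].
    have mI : measurable (U `&` U') by exact: measurableI.
    exists (V `|` W); split; [exact: measurableU|exact: setUSS|].
    apply/eqP; rewrite eq_le (bi_ge0 bc) ?andbT//; last exact: measurableU.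
    rewrite (le_trans (sub_subadd (biadditive_right bc mI) mV mW))//.
    rewrite -[leRHS](addr0 0) -{1}V0 -W0 lerD//.
      by apply: (bi_mono bc) => //; exact: subIsetl.
    by apply: (bi_mono bc) => //; exact: subIsetr.
  - move=> [U [pU mU [W [mW KW W0]]]]; apply: (Hp U pU).
    exists U; split => //.
    apply/eqP; rewrite eq_le (bi_ge0 bc)// andbT -W0.
    exact: (bi_mono bc).
exists p, q; split => // U V pU mU qV mV; rewrite lt_neqAle (bi_ge0 bc)// andbT.
apply/negP => /eqP cUV; apply: (Hq V qV); exists U; split => //.
by exists V; split => //; exact: subIsetl.
Qed.

Section place_dist.
Context {R : realType} d (X : measurableType d) (mu : probability X R).
Context (T : R -> X -> X) (fT : mp_flow mu T) (eT : ergodic mu T).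
Context (P : probability (R * R)%type R).

Let tau := prod_flow (fun (_ : R) (p : R * R) => p) T.

(* By ergodicity such a [k] is the product of its first marginal with [mu]. *)
Lemma submeasure_section_le (k : set ((R * R) * X) -> R) (U : set (R * R))
    (D : set ((R * R) * X)) (e : R) :
  submeasure (P \x mu)%E k ->
  (forall s D, measurable D -> k (tau s @^-1` D) = k D) ->
  measurable U -> measurable D -> D `<=` fst @^-1` U -> 0 <= e ->
  (forall p, U p -> (mu (xsection D p) <= e%:E)%E) ->
  k D <= e * k (fst @^-1` U).
Proof.
move=> sk invk mU mD DU e0 De.
have PT := product_probability_setT P mu.
pose m : {measure set ((R * R) * X) -> \bar R} := (P \x mu)%E.
have [|m' mE] := measure_finite_pack (m := m).
  by rewrite /m [ltLHS]PT ltry.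
have [K KE] : exists K : {finite_measure set ((R * R) * X)%type -> \bar R},
    forall A, measurable A -> K A = (k A)%:E.
  by apply: (submeasure_measure (m := m')); rewrite mE.
have mfst V : measurable V -> measurable ((fst : (R * R) * X -> R * R) @^-1` V).
  by move=> mV; rewrite -[X in measurable X]setTI; exact: measurable_fst.
have PXE V A : measurable V -> measurable A ->
    (P \x mu)%E (V `*` A) = (P V * mu A)%E.
  by move=> mV mA; rewrite [LHS]product_measure1E.
have kX V A : measurable V -> measurable A ->
    k (V `*` A) = k (fst @^-1` V) * fine (mu A).
  move=> mV mA; rewrite -setXT.
  apply: (ergodic_submeasure (probability_setT mu) (measurable_flow_at fT)
    (flow_preserving fT) eT (k := fun A => k (V `*` A))) => //.
    split => [C mC|C C' mC mC' CC'|C mC].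
    - by apply: (sub_ge0 sk); exact: measurableX.
    - have -> : V `*` (C `|` C') = V `*` C `|` V `*` C'.
        by apply/seteqP; split => -[p x]; [move=> [/= ? [?|?]]; [left|right]|
          move=> [[/= ? ?]|[/= ? ?]]; split => //; [left|right]].
      rewrite (subU sk)//; [exact: measurableX|exact: measurableX|].
      rewrite -subset0 => -[p x] [[_ Cx] [_ C'x]].
      by have : (C `&` C') x by []; rewrite CC'.
    - rewrite (le_trans (sub_le sk (measurableX mV mC)))// PXE//.
      rewrite -[leRHS]mul1e lee_wpmul2r// probability_le1//.
  by move=> s C mC; rewrite -[RHS](invk s)//; exact: measurableX.
pose kf (V : set (R * R)) := k (fst @^-1` V).
have skf : submeasure P kf.
  split => [V mV|V V' mV mV' VV'|V mV].
  - by apply: (sub_ge0 sk); exact: mfst.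
  - rewrite /kf preimage_setU (subU sk)//; [exact: mfst|exact: mfst|].
    by rewrite -preimage_setI VV' preimage_set0.
  - rewrite (le_trans (sub_le sk (mfst _ mV)))// -setXT PXE//.
    by rewrite -[leRHS]mule1 lee_wpmul2l// probability_le1.
have [Kf KfE] := submeasure_measure skf.
have KD : (Kf \x mu)%E D = K D.
  apply: product_measure_unique => // V A mV mA.
  rewrite [LHS]KE; last exact: measurableX.
  rewrite kX// EFinM fineK ?fin_num_measure//.
  by congr (_ * _)%E; exact/esym/KfE.
rewrite -lee_fin -KE// -KD -/(kf U) EFinM -KfE//.
apply: (@le_trans _ _ (\int[Kf]_(p in U) cst e%:E p)%E); last by rewrite integral_cst.
rewrite integral_mkcond; apply: ge0_le_integral => //.
- exact: measurable_fun_xsection.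
- apply/(measurable_restrictT _ _).1 => //; exact: measurable_cst.
- move=> p _ /=; rewrite patchE; have [/set_mem Up|/negP nUp] := boolP (p \in U).
    exact: De.
  rewrite (_ : xsection D p = set0) ?measure0// -subset0 => x /xsectionP /DU Up.
  by apply: nUp; exact/mem_set.
Qed.

(** Above [U] the time [h p] is close to [h p0], so continuity of the flow makes the sections of the
    difference small. The bound is relative to the mass of [k] above [U], which may be far below
    [P U], and [dl] is chosen before [k] and [U]: in the application both depend on such radii, and
    the mass is divided out. *)
Lemma place_dist (h : R * R -> R) (A : set X) (p0 : R * R) (e : R) :
  measurable_fun setT h -> measurable A -> 0 < e ->
  exists2 dl : R, 0 < dl & forall (k : set ((R * R) * X) -> R) U,
    submeasure (P \x mu)%E k ->
    (forall s D, measurable D -> k (tau s @^-1` D) = k D) ->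
    measurable U -> (forall p, U p -> `|h p - h p0| < dl) ->
    k (fst @^-1` U `&` (place T h @^-1` A `+`
      place T (fun=> 0) @^-1` (T (- h p0) @^-1` A))) <= e * k (fst @^-1` U).
Proof.
move=> mh mA e0; have [dl dl0 H] := flow_symdiff_le fT mA e0.
exists dl => // k U sk invk mU HU.
have mTA : measurable (T (- h p0) @^-1` A) by exact: (measurable_flow_preimage _ fT).
apply: submeasure_section_le => //; last 2 first.
- exact: ltW.
- move=> p Up; rewrite (le_trans _ (H (- h p) (- h p0) _))//.
    rewrite le_eqVlt; apply/orP; left; apply/eqP; congr (mu _).
    rewrite xsectionE; apply/seteqP; split => x; rewrite /setY /place /=.
      by rewrite oppr0 (flow0 fT) => -[].
    by rewrite oppr0 (flow0 fT).
  by rewrite -opprD normrN HU.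
- apply: measurableI.
    by rewrite -[X in measurable X]setTI; exact: measurable_fst.
  by apply: measurableU; apply: measurableD; rewrite -[X in measurable X]setTI;
    apply: (measurable_place fT).
Qed.

End place_dist.

Lemma mean_sum (R : realType) (M : (R -> R) -> R) (MM : invariant_mean M)
    (v : R -> R) (f : nat -> R) n : bounded_family v ->
  M (fun t => \sum_(j < n) v (t + f j)) = n%:R * M v.
Proof.
move=> bv; elim: n => [|n ih].
  under eq_fun do rewrite big_ord0.
  by rewrite (mean_cst MM) mul0r.
have bf s : bounded_family (fun t => v (t + s)).
  exact: (bounded_family_comp (fun t => t + s) bv).
have bs k : bounded_family (fun t => \sum_(j < k) v (t + f j)).
  elim: k => [|k ihk]; under eq_fun do rewrite ?big_ord0 ?big_ord_recr/=.
    exact: bounded_family_cst.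
  exact: bounded_familyD.
under eq_fun do rewrite big_ord_recr/=.
by rewrite (meanD MM (bs n) (bf (f n))) ih (mean_shift MM)// -natr1 mulrDl mul1r.
Qed.

(* Finitely many translates of the periodic set where [v >= e] cover the line. *)
Lemma mean_periodic_gt0 (R : realType) (M : (R -> R) -> R) (v : R -> R) (p dl e : R) :
  invariant_mean M -> bounded_family v -> (forall t, 0 <= v t) ->
  0 < p -> (forall t, v (t + p) = v t) -> 0 < dl -> 0 < e ->
  (forall t, `|t| < dl -> e <= v t) -> 0 < M v.
Proof.
move=> MM bv v0 p0 vp dl0 e0 ve.
have vpk (k : int) t : v (t + k%:~R * p) = v t.
  have vpn (n : nat) u : v (u + n%:R * p) = v u.
    elim: n u => [|n ih] u; first by rewrite mul0r addr0.
    by rewrite -natr1 mulrDl mul1r addrA vp ih.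
  case: k => n; first exact: vpn.
  by rewrite NegzE mulrNz mulNr -[LHS](vpn n.+1) subrK.
pose eta := dl / 2; have eta0 : 0 < eta by rewrite divr_gt0.
pose N := (Num.truncn (p / eta)).+1.
have vsum t : e <= \sum_(j < N) v (t + j%:R * eta).
  (* The next multiple of [p] lies at a distance [s] between 0 and [p] from [t]. Steps of length
     [eta] come within [eta < dl] of it, and periodicity carries that point close to 0. *)
  pose k := Num.ceil (t / p); pose s := k%:~R * p - t.
  have /andP[k1 k2] := ceil_itv (t / p).
  have s0 : 0 <= s by rewrite subr_ge0 -ler_pdivrMr.
  have sp : s <= p.
    move: k1; rewrite ltr_pdivlMr// intrB mulrBl mul1r /s -/k => ?; lra.
  pose j0 := Num.truncn (s / eta).
  have /andP[j1 j2] : j0%:R <= s / eta < j0.+1%:R.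
    by apply: truncn_itv; rewrite divr_ge0// ltW.
  have j0N : (j0 < N)%N.
    by rewrite ltnS; apply: le_truncn; rewrite ler_pM2r ?invr_gt0.
  rewrite (bigD1 (Ordinal j0N))//= ler_wpDr//; first by apply: sumr_ge0 => i _.
  rewrite -(vpk (- k)); apply: ve.
  rewrite ler_pdivlMr// in j1; rewrite ltr_pdivrMr// -natr1 mulrDl mul1r in j2.
  have etadl : eta < dl by rewrite ltr_pdivrMr// ltr_pMr// ltr1n.
  rewrite mulrNz mulNr ltr_norml; rewrite /s in j1 j2; apply/andP; split; lra.
have bs : bounded_family (fun t => \sum_(j < N) v (t + j%:R * eta)).
  have [b bb] := bv; exists (N%:R * b) => t.
  rewrite (le_trans (ler_norm_sum _ _ _))// mulr_natl -[X in _ *+ X]card_ord -sumr_const.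
  by apply: ler_sum => j _; exact: bb.
have := mean_le MM (bounded_family_cst e) bs vsum.
rewrite (mean_cst MM) (mean_sum MM (fun j => j%:R * eta) N bv) => /(lt_le_trans e0).
by rewrite pmulr_rgt0// ltr0n.
Qed.

(** * Periodicity from the coupling above a support point *)

Section disjointness.
Context {R : realType} dX dY (X : measurableType dX) (Y : measurableType dY).
Context (mu : probability X R) (nu : probability Y R).
Context (T : R -> X -> X) (S : R -> Y -> Y).
Context (fT : mp_flow mu T) (fS : mp_flow nu S).

Let tau := prod_flow (fun (_ : R) (p : R * R) => p) T.
Let sig := prod_flow (fun (_ : R) (p : R * R) => p) S.

(** [tau] and [sig] fix the plane, so restricting the coupling to the part above [U] and [V] keeps
    it invariant. *)
Lemma coupling_subjoining (r : set X -> set Y -> R)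
    (L : set ((R * R) * X) -> set ((R * R) * Y) -> R) (h : R * R -> R)
    (U V : set (R * R)) :
  biadditive L ->
  (forall s D D', measurable D -> measurable D' ->
    L (tau s @^-1` D) (sig s @^-1` D') = L D D') ->
  (forall A B, measurable A -> measurable B ->
    L (place T h @^-1` A) (place S h @^-1` B) <= r A B) ->
  measurable_fun setT h -> measurable U -> measurable V ->
  subjoining T S r (fun A B => L (fst @^-1` U `&` place T h @^-1` A)
                                 (fst @^-1` V `&` place S h @^-1` B)).
Proof.
move=> bL invL overL mh mU mV.
have mUT A : measurable A -> measurable (fst @^-1` U `&` place T h @^-1` A).
  move=> mA; apply: measurableI; rewrite -[X in measurable X]setTI.
    exact: measurable_fst.
  exact: (measurable_place fT).
have mVS B : measurable B -> measurable (fst @^-1` V `&` place S h @^-1` B).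
  move=> mB; apply: measurableI; rewrite -[X in measurable X]setTI.
    exact: measurable_fst.
  exact: (measurable_place fS).
have mpT A : measurable A -> measurable (place T h @^-1` A).
  by move=> mA; rewrite -[X in measurable X]setTI; exact: (measurable_place fT).
have mpS B : measurable B -> measurable (place S h @^-1` B).
  by move=> mB; rewrite -[X in measurable X]setTI; exact: (measurable_place fS).
split; first split.
- by move=> A B mA mB; apply: (bi_ge0 bL); [exact: mUT|exact: mVS].
- move=> A A' B mA mA' mB AA'; rewrite preimage_setU setIUr (bi_Ul bL)//.
  + exact: mUT.
  + exact: mUT.
  + exact: mVS.
  + by rewrite setIACA -[X in _ `&` X]preimage_setI AA' preimage_set0 setI0.
- move=> A B B' mA mB mB' BB'; rewrite preimage_setU setIUr (bi_Ur bL)//.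
  + exact: mUT.
  + exact: mVS.
  + exact: mVS.
  + by rewrite setIACA -[X in _ `&` X]preimage_setI BB' preimage_set0 setI0.
- move=> A B mA mB; rewrite (le_trans _ (overL A B mA mB))//.
  apply: (bi_mono bL); [exact: mUT|exact: mpT|exact: mVS|exact: mpS| |].
    exact: subIsetr.
  exact: subIsetr.
- move=> t A B mA mB; rewrite -[RHS](invL t); [|exact: mUT|exact: mVS].
  by rewrite !preimage_setI -!(place_preimage fT) -!(place_preimage fS).
Qed.

Section extremal.
Context (eT : ergodic mu T) (eS : ergodic nu S).
Context (P Q : probability (R * R)%type R).
Context (r : set X -> set Y -> R) (jr : bijoining mu nu T S r).
Context (A : set X) (B : set Y) (mA : measurable A) (mB : measurable B).
Context (ext : forall th, subjoining T S r th -> forall s,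
  th A (S s @^-1` B) = th setT setT * r A (S s @^-1` B)).
Context (L : set ((R * R) * X) -> set ((R * R) * Y) -> R) (bL : biadditive L).
Context (LP : forall D, measurable D -> ((L D setT)%:E <= (P \x mu)%E D)%E).
Context (LQ : forall D', measurable D' -> ((L setT D')%:E <= (Q \x nu)%E D')%E).
Context (invL : forall s D D', measurable D -> measurable D' ->
  L (tau s @^-1` D) (sig s @^-1` D') = L D D').
Context (overL : forall h, [\/ h = fst, h = snd | h = fun=> 0] ->
  forall A B, measurable A -> measurable B ->
  L (place T h @^-1` A) (place S h @^-1` B) <= r A B).

Let m1 (U : set (R * R)) : measurable U ->
  measurable ((fst : (R * R) * X -> R * R) @^-1` U).
Proof. by move=> mU; rewrite -[X in measurable X]setTI; exact: measurable_fst. Qed.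

Let m2 (V : set (R * R)) : measurable V ->
  measurable ((fst : (R * R) * Y -> R * R) @^-1` V).
Proof. by move=> mV; rewrite -[X in measurable X]setTI; exact: measurable_fst. Qed.

Let place_setT h (U : set (R * R)) :
  fst @^-1` U `&` place T h @^-1` setT = fst @^-1` U.
Proof. by rewrite preimage_setT setIT. Qed.

Let place_setT' h (V : set (R * R)) :
  fst @^-1` V `&` place S h @^-1` setT = fst @^-1` V.
Proof. by rewrite preimage_setT setIT. Qed.

Let subL V : measurable V -> submeasure (P \x mu)%E (L^~ (fst @^-1` V)).
Proof.
move=> mV; have := biadditive_left bL (m2 mV).
move=> [s1 s2 _]; split => // D mD; rewrite (le_trans _ (LP mD))// lee_fin.
by apply: (bi_mono bL) => //; exact: m2.
Qed.

Let subR U : measurable U -> submeasure (Q \x nu)%E (L (fst @^-1` U)).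
Proof.
move=> mU; have := biadditive_right bL (m1 mU).
move=> [s1 s2 _]; split => // D mD; rewrite (le_trans _ (LQ mD))// lee_fin.
by apply: (bi_mono bL) => //; exact: m1.
Qed.

Let invl V s D : measurable V -> measurable D ->
  L (tau s @^-1` D) (fst @^-1` V) = L D (fst @^-1` V).
Proof. by move=> mV mD; rewrite -[RHS](invL s)//; exact: m2. Qed.

Let invr U s D : measurable U -> measurable D ->
  L (fst @^-1` U) (sig s @^-1` D) = L (fst @^-1` U) D.
Proof. by move=> mU mD; rewrite -[RHS](invL s)//; exact: m1. Qed.

(* Compare the subjoinings placed at the coordinates [h] and [0] above small
   neighbourhoods of [p0] and [q0]: both are multiples of [r] on the orbit of
   [(A, B)], and they differ almost by [T (- h p0)] and [S (- h q0)]. *)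
Lemma extremal_periodic (h : R * R -> R) (p0 q0 : R * R) (s : R) :
  h = fst \/ h = snd ->
  (forall U V, nbhs p0 U -> measurable U -> nbhs q0 V -> measurable V ->
    0 < L (fst @^-1` U) (fst @^-1` V)) ->
  r A (S s @^-1` B) = r A (S (s + (h p0 - h q0)) @^-1` B).
Proof.
move=> hE Lgt0.
have mh : measurable_fun [set: R * R] h.
  by case: hE => ->; [exact: measurable_fst|exact: measurable_snd].
have ch : continuous h by case: hE => -> p; [exact: cvg_fst|exact: cvg_snd].
have m0 : measurable_fun [set: R * R] (fun=> 0 : R) by exact: measurable_cst.
have mT t C : measurable C -> measurable (T t @^-1` C).
  exact: (measurable_flow_preimage t fT).
have mS t C : measurable C -> measurable (S t @^-1` C).
  exact: (measurable_flow_preimage t fS).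
apply/eqP; rewrite -subr_eq0 -normr_le0; apply/ler_addgt0Pr => e e0; rewrite add0r.
have e20 : 0 < e / 2 by rewrite divr_gt0.
set B' := S s @^-1` B; have mB' : measurable B' by exact: mS.
have [d1 d10 H1] := place_dist fT eT P p0 mh mA e20.
have [d2 d20 H2] := place_dist fS eS Q q0 mh mB' e20.
pose ball (p : R * R) dl := [set q | `|h q - h p| < dl].
have mball p dl : measurable (ball p dl).
  rewrite (_ : ball p dl = h @^-1` `]h p - dl, h p + dl[%classic).
    by rewrite -[X in measurable X]setTI; exact: mh.
  by apply/seteqP; split => q; rewrite /ball/= in_itv/= ltr_distl.
have nball p dl : 0 < dl -> nbhs p (ball p dl).
  move=> dl0; have /cvgrPdist_lt /(_ _ dl0) := ch p.
  by apply: filterS => q; rewrite /ball/= distrC.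
set U := ball p0 d1; set V := ball q0 d2.
have mU : measurable U by exact: mball.
have mV : measurable V by exact: mball.
have c0 : 0 < L (fst @^-1` U) (fst @^-1` V).
  by apply: Lgt0 => //; exact: nball.
set c := L _ _ in c0.
have hE3 : [\/ h = fst, h = snd | h = fun=> 0] by case: hE => ->; [apply: Or31|apply: Or32].
have sj1 := coupling_subjoining bL invL (overL hE3) mh mU mV.
have sj0 := coupling_subjoining bL invL (overL (Or33 _ _ erefl)) m0 mU mV.
have e1 := ext sj1 s; rewrite !(place_setT, place_setT') -/c -/B' in e1.
have e2 := ext sj0 (s + (h p0 - h q0)).
rewrite !(place_setT, place_setT') -/c in e2.
(* Invariance applies the time [- h p0] to both sets: [A] becomes nearly what the coordinate [h]
   sees above [p0], and for [B] the time becomes [s + (h p0 - h q0) - h p0 = s - h q0]. *)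
rewrite -(sj_inv sj0 (- h p0)) in e2; [|by []|exact: mS].
have SE : S (- h p0) @^-1` (S (s + (h p0 - h q0)) @^-1` B) = S (- h q0) @^-1` B'.
  apply/seteqP; split => y; rewrite /B'/= -!(flowD fS);
    by rewrite (_ : s + (h p0 - h q0) + - h p0 = s - h q0)//; ring.
rewrite SE in e2.
have K1 := H1 (L^~ (fst @^-1` V)) U (subL mV) (fun s D mD => invl s mV mD) mU (fun _ => id).
have K2 := H2 (L (fst @^-1` U)) V (subR mU) (fun s D mD => invr s mU mD) mV (fun _ => id).
(* Both errors are at most proportional to [c], the common mass of the two subjoinings, so [c]
   cancels however small it is. *)
rewrite -(ler_pM2l c0) -[X in X * `| _ |](gtr0_norm c0) -normrM mulrBr -e1 -e2.
set D1 := _ `&` place T h @^-1` _; set D0 := fst @^-1` U `&` _.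
set E1 := _ `&` place S h @^-1` _; set E0 := fst @^-1` V `&` _.
have mp g C : measurable_fun setT g -> measurable C -> measurable (place T g @^-1` C).
  by move=> mg mC; rewrite -[X in measurable X]setTI; exact: (measurable_place fT).
have mq g C : measurable_fun setT g -> measurable C -> measurable (place S g @^-1` C).
  by move=> mg mC; rewrite -[X in measurable X]setTI; exact: (measurable_place fS).
have mD1 : measurable D1 by apply: measurableI; [exact: m1|exact: mp].
have mD0 : measurable D0 by apply: measurableI; [exact: m1|apply: mp => //; exact: mT].
have mE1 : measurable E1 by apply: measurableI; [exact: m2|exact: mq].
have mE0 : measurable E0 by apply: measurableI; [exact: m2|apply: mq => //; exact: mS].
have -> : L D1 E1 - L D0 E0 = (L D1 E1 - L D0 E1) + (L D0 E1 - L D0 E0) by ring.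
rewrite (splitr e) mulrDr (le_trans (ler_normD _ _))// lerD//.
  rewrite mulrC (le_trans _ K1)//.
  rewrite (le_trans (sub_dist (biadditive_left bL mE1) mD1 mD0))//.
  have mDD : measurable (D1 `+` D0) by apply: measurableU; exact: measurableD.
  apply: (bi_mono bL) => //; [|exact: m2| |exact: subIsetl].
    apply: measurableI; first exact: m1.
    by apply: measurableU; apply: measurableD; apply: mp => //; exact: mT.
  by move=> z [[[Uz Az] nz]|[[Uz Az] nz]]; split => //; [left|right]; split => // ?; apply: nz.
rewrite mulrC (le_trans _ K2)//.
rewrite (le_trans (sub_dist (biadditive_right bL mD0) mE1 mE0))//.
have mEE : measurable (E1 `+` E0) by apply: measurableU; exact: measurableD.
apply: (bi_mono bL) => //; [exact: m1| |exact: subIsetl|].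
  apply: measurableI; first exact: m2.
  by apply: measurableU; apply: measurableD; apply: mq => //; exact: mS.
by move=> z [[[Uz Az] nz]|[[Uz Az] nz]]; split => //; [left|right]; split => // ?; apply: nz.
Qed.

End extremal.
End disjointness.

Lemma joining_bijoining (R : realType) dX dY (X : measurableType dX)
    (Y : measurableType dY) (mu : probability X R) (nu : probability Y R)
    (T : R -> X -> X) (S : R -> Y -> Y) (rho : probability (X * Y)%type R) :
  joining mu nu T S rho -> bijoining mu nu T S (fun A B => fine (rho (A `*` B))).
Proof.
move=> [inv ml mr]; have fr A B : measurable A -> measurable B ->
    rho (A `*` B) \is a fin_num.
  by move=> mA mB; apply: fin_num_measure; exact: measurableX.
split; first split.
- by move=> A B mA mB; rewrite fine_ge0.
- move=> A A' B mA mA' mB AA'; rewrite -fineD ?fr// -measureU; first last.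
  + by rewrite -subset0 => -[x y] [[/= Ax _] [/= A'x _]];
      have : (A `&` A') x by []; rewrite AA'.
  + exact: measurableX.
  + exact: measurableX.
  + congr (fine (rho _)); apply/seteqP; split => -[x y] /=.
      by move=> [[?|?] ?]; [left|right].
    by move=> [[? ?]|[? ?]]; split => //; [left|right].
- move=> A B B' mA mB mB' BB'; rewrite -fineD ?fr// -measureU; first last.
  + by rewrite -subset0 => -[x y] [[/= _ Bx] [/= _ B'x]];
      have : (B `&` B') y by []; rewrite BB'.
  + exact: measurableX.
  + exact: measurableX.
  + congr (fine (rho _)); apply/seteqP; split => -[x y] /=.
      by move=> [? [?|?]]; [left|right].
    by move=> [[? ?]|[? ?]]; split => //; [left|right].
- by move=> A mA; rewrite ml.
- by move=> B mB; rewrite mr.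
- by move=> t A B mA mB; rewrite -[in RHS](inv t) //; exact: measurableX.
Qed.

(** * The product formula for bijoinings, and disjointness *)

Section bound.
Context {R : realType} dX dY (X : measurableType dX) (Y : measurableType dY).
Context (mu : probability X R) (nu : probability Y R).
Context (T : R -> X -> X) (S : R -> Y -> Y).
Context (a b : nat -> R) (alpha alpha' : R).
Context (P Q : probability (R * R)%type R).
Context (xi1 : probability (X * X * X)%type R) (xi2 : probability (Y * Y * Y)%type R).
Context (fT : mp_flow mu T) (fS : mp_flow nu S).
Context (wT : weakly_mixing mu T) (wS : weakly_mixing nu S).
Context (al01 : 0 <= alpha < 1) (al'01 : 0 <= alpha' < 1).
Context (cvgT : joining3_cvg (fun n => offdiag mu T (a n) (b n))
  (fun A => (1 - alpha)%:E * offdiag_mix mu T P A + alpha%:E * xi1 A)%E).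
Context (cvgS : joining3_cvg (fun n => offdiag nu S (a n) (b n))
  (fun A => (1 - alpha')%:E * offdiag_mix nu S Q A + alpha'%:E * xi2 A)%E).
Context (B0 : set (R * R)) (mB0 : measurable B0).
Context (gap : alpha' < (1 - alpha) * fine (P B0) - (1 - alpha') * fine (Q B0)).

(** The hypothesis on [B0] says that the two weighted masses, of [B0] under [P] and of its
    complement under [Q], add up to [1 + dl] with [dl > 0]. Each inner approximation may cost a
    third of [dl]. *)
Let separated_compacts : exists K K' : set (R * R),
  [/\ compact K, compact K', measurable K /\ measurable K', K `&` K' = set0 &
    1 < (1 - alpha) * fine (P K) + (1 - alpha') * fine (Q K')].
Proof.
case/andP: al01 => al0 al1; case/andP: al'01 => al'0 al'1.
set dl := (1 - alpha) * fine (P B0) - (1 - alpha') * fine (Q B0) - alpha'.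
have dl0 : 0 < dl by rewrite subr_gt0.
have e0 : 0 < dl / 3 by rewrite divr_gt0.
have [K [cK mK KB PK]] := plane_compact_regular P mB0 e0.
have [K' [cK' mK' KB' QK']] := plane_compact_regular Q (measurableC mB0) e0.
exists K, K'; split => //.
  by rewrite -subset0 => p [/KB Bp /KB' nBp].
have sP := fine_submeasure P; have sQ := fine_submeasure Q.
have {}PK : fine (P B0) - fine (P K) <= dl / 3.
  have /= <- := subD sP mB0 mK KB.
  by rewrite -lee_fin fineK// fin_num_measure//; exact: measurableD.
have {}QK' : 1 - fine (Q B0) - fine (Q K') <= dl / 3.
  have mC : measurable (~` B0) by exact: measurableC.
  have /= QC := sub_setC sQ mB0; rewrite probability_setT/= in QC; rewrite -QC.
  have /= <- := subD sQ mC mK' KB'.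
  by rewrite -lee_fin fineK// fin_num_measure//; exact: measurableD.
have h1 : (1 - alpha) * (fine (P B0) - fine (P K)) <= dl / 3.
  by apply: (le_trans (ler_wpM2l _ PK)); [lra|apply: ler_piMl; [exact: ltW|lra]].
have h2 : (1 - alpha') * (1 - fine (Q B0) - fine (Q K')) <= dl / 3.
  by apply: (le_trans (ler_wpM2l _ QK')); [lra|apply: ler_piMl; [exact: ltW|lra]].
have : 0 < dl - dl / 3 - dl / 3 by lra.
rewrite {1}/dl; lra.
Qed.

(** Passing to the extremal [r] can only raise the value at (A, B), so it preserves an excess over
    the product but not a deficit; hence one inequality. *)
Lemma bijoining_le_product (r0 : set X -> set Y -> R) (A : set X) (B : set Y) :
  bijoining mu nu T S r0 -> measurable A -> measurable B ->
  r0 A B <= fine (mu A) * fine (nu B).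
Proof.
move=> jr0 mA mB; rewrite leNgt; apply/negP => gtAB.
have eT := weakly_mixing_ergodic fT wT; have eS := weakly_mixing_ergodic fS wS.
have [r [jr r0r ext]] := extremal_bijoining fT fS eT eS mA mB jr0.
have [L [bL Lle Lge invL overL]] := coupling_exists fT fS jr al01 al'01 cvgT cvgS.
case/andP: al01 => al0 al1; case/andP: al'01 => al'0 al'1.
have PXT V : measurable V -> (P \x mu)%E (fst @^-1` V) = P V.
  move=> mV; rewrite -setXT [LHS]product_measure1E// -[RHS]mule1.
  by congr (_ * _)%E; exact: probability_setT.
have QYT V : measurable V -> (Q \x nu)%E (fst @^-1` V) = Q V.
  move=> mV; rewrite -setXT [LHS]product_measure1E// -[RHS]mule1.
  by congr (_ * _)%E; exact: probability_setT.
have [K [K' [cK cK' [mK mK'] KK' gt1]]] := separated_compacts.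
have bc : biadditive (fun U V : set (R * R) => L (fst @^-1` U) (fst @^-1` V)).
  by apply: biadditive_preimage bL; exact: measurable_fst.
have mK1 : measurable ((fst : (R * R) * X -> R * R) @^-1` K).
  by rewrite -[X in measurable X]setTI; exact: measurable_fst.
have mK2 : measurable ((fst : (R * R) * Y -> R * R) @^-1` K').
  by rewrite -[X in measurable X]setTI; exact: measurable_fst.
have cKK' : 0 < L (fst @^-1` K) (fst @^-1` K').
  by apply: lt_le_trans (Lge _ _ mK1 mK2); rewrite PXT// QYT// subr_gt0.
have [p [q [Kp Kq Lpq]]] := support_point bc cK cK' mK mK' cKK'.
have LP D : measurable D -> ((L D setT)%:E <= (P \x mu)%E D)%E.
  move=> mD; have [H _] := Lle D setT mD measurableT.
  have s := submeasureZ (c := 1 - alpha) _ (product_fine_submeasure P mu).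
  apply: le_trans (sub_le (s _) mD); first by rewrite lee_fin.
  by apply/andP; split; lra.
have LQ D : measurable D -> ((L setT D)%:E <= (Q \x nu)%E D)%E.
  move=> mD; have [_ H] := Lle setT D measurableT mD.
  have s := submeasureZ (c := 1 - alpha') _ (product_fine_submeasure Q nu).
  apply: le_trans (sub_le (s _) mD); first by rewrite lee_fin.
  by apply/andP; split; lra.
have per h s : h = fst \/ h = snd ->
    r A (S s @^-1` B) = r A (S (s + (h p - h q)) @^-1` B).
  by move=> hE; apply: (extremal_periodic fT fS eT eS mA mB ext bL LP LQ).
have [w [w0 perw]] : exists w, w != 0 /\ forall s, r A (S s @^-1` B) = r A (S (s + w) @^-1` B).
  have pq : p != q.
    apply/negP => /eqP pq; have : (K `&` K') p by split => //; rewrite pq.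
    by rewrite KK'.
  have [p1|p1] := eqVneq p.1 q.1; last first.
    by exists (p.1 - q.1); split; [rewrite subr_eq0|move=> s; apply: per; left].
  have [p2|p2] := eqVneq p.2 q.2; last first.
    by exists (p.2 - q.2); split; [rewrite subr_eq0|move=> s; apply: per; right].
  by move: pq; rewrite [p]surjective_pairing [q]surjective_pairing p1 p2 eqxx.
have [M MM] := @invariant_mean_exists R.
have sr := bijoining_submeasure_r jr mA.
have := weak_mixing_mean fS wS MM sr mB; rewrite (bij_l jr)//.
set m := fine (mu A) * fine (nu B) in gtAB *.
pose u t := r A (S t @^-1` B).
have mSB t : measurable (S t @^-1` B) by exact: (measurable_flow_preimage t fS).
have S0 : S 0 @^-1` B = B by apply/seteqP; split => y /=; rewrite (flow0 fS).
have u0 : m < u 0 by rewrite /u S0 (lt_le_trans gtAB).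
(* Half of the excess: near time 0 the function stays at least [e] above the product, so its squared
   deviation is at least [e ^+ 2] there and, being periodic, has positive mean. *)
pose e := (u 0 - m) / 2; have e0 : 0 < e by rewrite divr_gt0// subr_gt0.
have [dl dl0 Hdl] := flow_submeasure_continuous fS sr mB e0.
have bu : bounded_family u.
  apply: (@bounded_family_itv _ _ _ 0 1) => t; rewrite (bi_ge0 jr)//=.
  rewrite -(bijoining_setTT jr); exact: (bi_mono jr).
have bv : bounded_family (fun t => (u t - m) ^+ 2).
  have bum := bounded_familyB bu (bounded_family_cst m).
  by have := bounded_familyM bum bum; under eq_fun do rewrite -expr2.
have uw t : u (t + `|w|) = u t.
  have [w_ge0|w_lt0] := leP 0 w; first by rewrite /u ger0_norm// -perw.
  by rewrite /u ltr0_norm// [LHS]perw addrNK.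
apply/eqP; rewrite gt_eqF//.
apply: (mean_periodic_gt0 (p := `|w|) (dl := dl) (e := e ^+ 2) MM bv) => //.
- by move=> t; exact: sqr_ge0.
- by rewrite normr_gt0.
- by move=> t; rewrite uw.
- by rewrite exprn_gt0.
move=> t tdl; have := Hdl t 0; rewrite subr0 => /(_ tdl).
rewrite -/(u t) -/(u 0) ler_norml => /andP[h1 _].
have h2 : e <= u t - m by rewrite /e in h1 *; lra.
by rewrite ler_pXn2r// nnegrE; lra.
Qed.

(** The upper bounds for [A] and for its complement add up to [nu B], which is also the sum of the
    two values, so both are equalities. *)
Lemma bijoining_product (r0 : set X -> set Y -> R) (A : set X) (B : set Y) :
  bijoining mu nu T S r0 -> measurable A -> measurable B ->
  r0 A B = fine (mu A) * fine (nu B).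
Proof.
move=> jr0 mA mB; apply/eqP; rewrite eq_le bijoining_le_product//=.
have mC : measurable (~` A) by exact: measurableC.
have := bijoining_le_product jr0 mC mB.
have /= -> := sub_setC (biadditive_left jr0 mB) mA.
have /= -> := sub_setC (fine_submeasure mu) mA.
rewrite (bij_r jr0)// probability_setT/=; lra.
Qed.

End bound.

Theorem proposition3p2 (R : realType) (dX dY : measure_display)
  (X : measurableType dX) (Y : measurableType dY)
  (mu : probability X R) (nu : probability Y R)
  (T : R -> X -> X) (S : R -> Y -> Y)
  (a b : nat -> R) (alpha alpha' : R)
  (P Q : probability (R * R)%type R)
  (xi1 : probability (X * X * X)%type R)
  (xi2 : probability (Y * Y * Y)%type R)
  (B : set (R * R)) :
  standard_borel R X -> standard_borel R Y ->
  mp_flow mu T -> mp_flow nu S ->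
  weakly_mixing mu T -> weakly_mixing nu S ->
  0 <= alpha < 1 -> 0 <= alpha' < 1 ->
  self_joining3 mu T xi1 -> self_joining3 nu S xi2 ->
  joining3_cvg (fun n => offdiag mu T (a n) (b n))
    (fun A => (1 - alpha)%:E * offdiag_mix mu T P A + alpha%:E * xi1 A)%E ->
  joining3_cvg (fun n => offdiag nu S (a n) (b n))
    (fun A => (1 - alpha')%:E * offdiag_mix nu S Q A + alpha'%:E * xi2 A)%E ->
  measurable B ->
  (alpha'%:E < (1 - alpha)%:E * P B - (1 - alpha')%:E * Q B)%E ->
  disjoint_flows mu nu T S.
Proof.
move=> _ _ fT fS wT wS al01 al'01 _ _ cvgT cvgS mB gap rho.
have {}gap : alpha' < (1 - alpha) * fine (P B) - (1 - alpha') * fine (Q B).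
  by rewrite -lte_fin EFinB !EFinM !fineK ?fin_num_measure.
split=> [jrho C mC|rhoE].
  apply/esym/product_measure_unique => // A1 A2 mA1 mA2.
  have /= E := bijoining_product fT fS wT wS al01 al'01 cvgT cvgS mB gap
    (joining_bijoining jrho) mA1 mA2.
  rewrite -[LHS]fineK; last by apply: fin_num_measure; exact: measurableX.
  by rewrite E EFinM !fineK ?fin_num_measure.
split=> [t C mC|A1 mA1|A2 mA2].
- rewrite !rhoE//; first exact: prod_flow_invariant.
  exact: (measurable_prod_flow_preimage fT fS).
- rewrite rhoE; last exact: measurableX.
  rewrite [LHS]product_measure1E// -[RHS]mule1; congr (_ * _)%E.
  exact: probability_setT.
- rewrite rhoE; last exact: measurableX.
  rewrite [LHS]product_measure1E// -[RHS]mul1e; congr (_ * _)%E.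
  exact: probability_setT.
Qed.
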